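(* Let $n \geq 20$ be an even integer. Then there exist infinitely many polynomials $f \in \mathbb{Q}[x]$ of degree $n$ such that, for $t = 0$, the point $0$ is not periodic under $f$, all iterates $f^{\circ m}(x)$ ($m \geq 1$) are separable, and the arboreal Galois representation $\phi: \operatorname{Gal}(\overline{\mathbb{Q}}/\mathbb{Q}) \to \operatorname{Aut}(T_\infty)$ attached to $f$ and $t=0$ is surjective.
   Context: Let $K$ be a field, $f \in K[x]$ a polynomial of degree $d \geq 2$ and $t \in K$. Write $f^{\circ n}$ for the $n$-th iterate of $f$ ($f^{\circ 0}(x) = x$). Assume $t$ is not a periodic point of $f$ and that $f^{\circ n}(x) - t$ is separable for all $n$. Fix a separable closure $K^{\mathrm{sep}}$. The preimage tree $T_\infty$ has as vertices the roots in $K^{\mathrm{sep}}$ of $f^{\circ n}(x)-t$ for all $n \geq 0$ (those of $f^{\circ n}(x)-t$ forming level $n$; the root of the tree is $t$), with an edge between $\alpha$ and $\beta$ whenever $f(\alpha) = \beta$; it is a complete rooted $d$-ary tree. The absolute Galois group $\operatorname{Gal}(K^{\mathrm{sep}}/K)$ acts on $T_\infty$ by tree automorphisms, giving a homomorphism $\phi: \operatorname{Gal}(K^{\mathrm{sep}}/K) \to \operatorname{Aut}(T_\infty)$, the arboreal Galois representation attached to $f$ and $t$. *)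

(* Defs.v *)
From HB Require Import structures.
From mathcomp Require Import all_boot all_order all_algebra all_field.
From mathcomp Require Import boolp classical_sets cardinality.

Set Implicit Arguments.
Unset Strict Implicit.
Unset Printing Implicit Defensive.

Import GRing.Theory.
Local Open Scope ring_scope.
Local Open Scope classical_set_scope.

Definition iter_poly (R : nzRingType) (f : {poly R}) (n : nat) : {poly R} :=
  iter n (fun g => f \Po g) 'X.

Definition periodic_pt (R : nzRingType) (f : {poly R}) (t : R) : Prop :=
  exists2 n : nat, (0 < n)%N & (iter_poly f n).[t] = t.

(* Throughout, L stands for a separable closure of K, with embedding iota.    *)
Section Arboreal.
Variables (K L : fieldType) (iota : {rmorphism K -> L}).

Record absGal := AbsGal {
  gal_fun :> {rmorphism L -> L};
  gal_bij : bijective gal_fun;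
  gal_fix : forall a : K, gal_fun (iota a) = iota a }.

Variables (f : {poly K}) (t : K).

Definition tree_level (n : nat) : set L :=
  [set x | root (map_poly iota (iter_poly f n - t%:P)) x].

Definition tree_vertices : set L := \bigcup_n tree_level n.

Definition vertex : Type := set_type tree_vertices.

Definition tree_adj (u v : vertex) : Prop :=
  (map_poly iota f).[val u] = val v \/ (map_poly iota f).[val v] = val u.

Lemma tree_root_subproof : iota t \in tree_vertices.
Proof.
apply: mem_set; exists 0%N => //=.
by rewrite /tree_level /= rmorphB /= map_polyX map_polyC rootE !hornerE subrr.
Qed.

Definition tree_root : vertex := Sub (iota t) tree_root_subproof.

Record treeAut := TreeAut {
  aut_fun :> vertex -> vertex;
  aut_bij : bijective aut_fun;
  aut_root : aut_fun tree_root = tree_root;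
  aut_adj : forall u v, tree_adj (aut_fun u) (aut_fun v) <-> tree_adj u v }.

Lemma treeAut_ext (u v : treeAut) : u =1 v -> u = v.
Proof.
case: u v => [u ub ur ua] [v vb vr va] /= /funext uv.
by subst v; congr TreeAut; apply: Prop_irrelevance.
Qed.

Lemma map_poly_gal (s : absGal) (p : {poly K}) :
  map_poly s (map_poly iota p) = map_poly iota p.
Proof. by apply/polyP => i; rewrite !coef_map /= gal_fix. Qed.

Lemma root_gal (s : absGal) (p : {poly K}) (x : L) :
  root (map_poly iota p) (s x) = root (map_poly iota p) x.
Proof. by rewrite -[in LHS](map_poly_gal s) fmorph_root. Qed.

Lemma gal_vertex (s : absGal) (x : L) :
  (s x \in tree_vertices) = (x \in tree_vertices).
Proof.
apply/idP/idP => /set_mem [n _ xn]; apply: mem_set; exists n => //; move: xn.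
  by rewrite /tree_level /= root_gal.
by rewrite /tree_level /= root_gal.
Qed.

Definition gal_act (s : absGal) (v : vertex) : vertex :=
  Sub (s (val v)) (etrans (gal_vertex s (val v)) (valP v)).

Lemma gal_act_bij (s : absGal) : bijective (gal_act s).
Proof.
have [g sK gK] := gal_bij s.
have gV (v : vertex) : g (val v) \in tree_vertices.
  by rewrite -(gal_vertex s) gK; apply: valP.
by exists (fun v => Sub (g (val v)) (gV v)) => v; apply: val_inj; rewrite /= ?sK ?gK.
Qed.

Lemma gal_act_root (s : absGal) : gal_act s tree_root = tree_root.
Proof. by apply: val_inj; rewrite /= gal_fix. Qed.

Lemma gal_act_adj (s : absGal) u v :
  tree_adj (gal_act s u) (gal_act s v) <-> tree_adj u v.
Proof.
have sE x : (map_poly iota f).[s x] = s (map_poly iota f).[x].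
  by rewrite -[in LHS](map_poly_gal s) horner_map.
rewrite /tree_adj /= !sE; split=> -[uv|uv].
- by left; apply: fmorph_inj uv.
- by right; apply: fmorph_inj uv.
- by left; rewrite uv.
- by right; rewrite uv.
Qed.

Definition arboreal_rep (s : absGal) : treeAut :=
  TreeAut (gal_act_bij s) (gal_act_root s) (gal_act_adj s).

End Arboreal.

(* Main.v *)
Require Import Defs.
From HB Require Import structures.
From mathcomp Require Import all_boot all_order all_algebra all_fingroup all_field.
From mathcomp Require Import boolp classical_sets cardinality filter.
From mathcomp Require Import zify ring.

(**
The polynomials are f = A x (x - 1)^(n-1) + 1 with A = n^k p / q, where q is a
prime congruent to 3 or 5 mod 8 and prime to n (n - 1), p is a large prime and
k >= n + 3 varies.  The critical points are 1, which is fixed, and 1/n; the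
base point 0 is mapped to the fixed point 1.

At p the roots of f^m have valuation -(1 + n + ... + n^(m-1)) / n^m, so each
Galois orbit of roots has size divisible by n^m: every f^m is irreducible.
At q there is, on each level, exactly one root b0 whose forward orbit reduces
to 0 until it reaches the base point, while its siblings b satisfy
v(b - 1) = 1/(n-1); hence the stabiliser of b0 permutes its siblings
transitively, and the Galois group is transitive on pairs of siblings.
The numerator of f^m(1/n) is congruent to q mod 8, so it is not plus or minus a
square, and some prime l divides it to an odd power.  Modulo a place above l
only two roots of f^m collide, and they collide to 1/n; since
the discriminant has odd valuation, inertia is nontrivial and must be the
transposition of these two roots.  Conjugating it yields all transpositions of
siblings, hence all permutations of level m fixing level m - 1, and induction on
m followed by a compactness argument gives surjectivity.
*)

Set Implicit Arguments.
Unset Strict Implicit.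
Unset Printing Implicit Defensive.

Import GRing.Theory Num.Theory.

(** * The numerators of the critical orbit *)

Lemma even_logn_square (x : nat) : 0 < x -> (forall l, prime l -> ~~ odd (logn l x)) ->
  exists y, x = y ^ 2.
Proof.
have [k] := ubnP x; elim: k x => // k IH x; rewrite ltnS => xk x0 ev.
have [x1|x1] := leqP x 1; first by exists 1; lia.
pose l := pdiv x; have l_pr : prime l by rewrite pdiv_prime.
have l2 : l ^ 2 %| x.
  have l1 : 0 < logn l x by rewrite logn_gt0 mem_primes l_pr x0 pdiv_dvd.
  rewrite pfactor_dvdn //; have := ev l l_pr; lia.
have [y yE] := dvdnP l2.
have y0 : 0 < y by rewrite lt0n; apply: contraL x0 => /eqP y0; rewrite yE y0.
have l0 := prime_gt1 l_pr.
have [|l' l'_pr|z zE] := IH y _ y0.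
- by rewrite (leq_trans _ xk) // yE ltn_Pmulr // (ltn_exp2l 0 2).
- have := ev l' l'_pr; rewrite yE lognM ?expn_gt0 ?(ltnW l0) // oddD lognX oddM /=.
  by rewrite addbF.
- by exists (z * l); rewrite yE zE expnMn.
Qed.

(** The classes 1 and 7 form a subgroup of the odd residues modulo 8, so dividing out a prime in
    them keeps the quotient in the classes 3 and 5. *)
Lemma mod8_prime_factor (x : nat) : x %% 8 \in [:: 3; 5] ->
  exists2 q, prime q & (q %| x) && (q %% 8 \in [:: 3; 5]).
Proof.
have [k] := ubnP x; elim: k x => // k IH x; rewrite ltnS => xk x8.
have x1 : 1 < x by case: x x8 {xk} => [|[]].
pose l := pdiv x; have l_pr : prime l by rewrite pdiv_prime.
have [l8|nl8] := boolP (l %% 8 \in [:: 3; 5]).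
  by exists l; rewrite // pdiv_dvd.
have [y yE] := dvdnP (pdiv_dvd x); rewrite -/l in yE.
have l0 := prime_gt1 l_pr.
have [||q q_pr /andP[qy q8]] := IH y.
- rewrite (leq_trans _ xk) // yE ltn_Pmulr // lt0n.
  by apply: contraTneq x1 => y0; rewrite yE y0.
- move: x8 nl8; rewrite yE -modnMm; have := ltn_pmod y (isT : 0 < 8).
  have := ltn_pmod l (isT : 0 < 8); move: (y %% 8) (l %% 8).
  by do 9?[case=> //]; do 9?[case=> //].
- by exists q => //; rewrite yE dvdn_mulr.
Qed.

(** With s the odd part of n (n - 1), the number 4 s^2 - 1 is congruent to 3 modulo 8 and prime to 2
    s; any prime factor of it in the classes 3 or 5 will do. *)
Lemma exists_prime_mod8 (n : nat) : 1 < n ->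
  exists q, [/\ prime q, q %% 8 \in [:: 3; 5] & coprime q (n * n.-1)].
Proof.
move=> n1; pose s := (n * n.-1)`_2^'; have s0 : 0 < s by rewrite part_gt0.
have sodd : odd s.
  by have := part_pnat 2^' (n * n.-1); rewrite p'natE // -/s dvdn2 negbK.
have [|q q_pr /andP[qx q8]] := @mod8_prime_factor (4 * s ^ 2 - 1).
  have [t ->] : exists t, s = t.*2.+1 by exists s./2; lia.
  have [w wE] : exists w, t * t.+1 = w.*2.
    by exists (t * t.+1)./2; rewrite -[LHS]odd_double_half oddM /= andbN.
  have -> : 4 * t.*2.+1 ^ 2 - 1 = (4 * w) * 8 + 3 by nia.
  by rewrite modnMDl.
exists q; split=> //; rewrite prime_coprime //; apply/negP => qn.
have q2 : q != 2 by apply: contraTneq q8 => ->.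
have qs : q %| s.
  rewrite -(partnC 2 (_ : 0 < n * n.-1)) ?Euclid_dvdM // in qn; last by lia.
  case/orP: qn => //; rewrite p_part Euclid_dvdX // => /andP[].
  by rewrite dvdn_prime2 // (negPf q2).
have : q %| 1.
  have -> : 1 = 4 * s ^ 2 - (4 * s ^ 2 - 1) by nia.
  by rewrite dvdn_sub // dvdn_mull // dvdn_exp.
by rewrite dvdn1 => /eqP q1; rewrite q1 in q_pr.
Qed.

Section CriticalOrbit.
Variables (n j p q : nat).

(* [edeg m = 1 + n + ... + n^(m-1)], the exponent of A in the leading
   coefficient of f^m. *)
Fixpoint edeg m := if m is m'.+1 then (n * edeg m').+1 else 0.

Open Scope ring_scope.

(* [crit_num m] is the numerator of f^(m+1)(1/n), see [crit_numE]. *)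
Fixpoint crit_num (m : nat) : int := if m is m'.+1
  then (n ^ (n + 3 + j) * p)%:Z * crit_num m' *
         (crit_num m' - (q ^ edeg m)%:Z) ^+ n.-1 + (q ^ edeg m.+1)%:Z
  else q%:Z - (n ^ (3 + j) * p * n.-1 ^ n.-1)%:Z.

Hypotheses (n_even : ~~ odd n) (n_gt1 : (1 < n)%N) (p_pr : prime p) (q_pr : prime q).
Hypotheses (q_mod8 : (q %% 8 \in [:: 3; 5])%N) (q_co : coprime q (n * n.-1)) (pq : p != q).

Lemma odd_edeg m : odd (edeg m.+1).
Proof. by rewrite /= oddM (negPf n_even). Qed.

(** Serves twice: modulo 8, which divides n^(3+j) because n is even, and modulo the primes dividing
    n or p. *)
Lemma crit_num_mod m : exists t, crit_num m = (q ^ edeg m.+1)%:Z + (n ^ (3 + j) * p)%:Z * t.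
Proof.
elim: m => [|m [t tE]]; first by exists (- (n.-1 ^ n.-1)%:Z); rewrite /= muln0 expn1; lia.
have -> : crit_num m.+1 = (n ^ (n + 3 + j) * p)%:Z * crit_num m *
  (crit_num m - (q ^ edeg m.+1)%:Z) ^+ n.-1 + (q ^ edeg m.+2)%:Z by [].
exists ((n ^ n)%:Z * crit_num m * (crit_num m - (q ^ edeg m.+1)%:Z) ^+ n.-1).
rewrite -addnA expnD !PoszM; ring.
Qed.

(** Modulo q the recursion reads N_(m+1) = n^(n+3+j) p N_m^n, and N_0 = -n^(3+j) p (n-1)^(n-1), so a
    factor q never appears. *)
Lemma crit_num_coprime_q m : coprime q `|crit_num m|.
Proof.
have qn : coprime q n by move: q_co; rewrite coprimeMr => /andP[].
have qn1 : coprime q n.-1 by move: q_co; rewrite coprimeMr => /andP[].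
have qp : coprime q p by rewrite prime_coprime // dvdn_prime2 // eq_sym.
have qD k : ~~ (q %| n ^ k * p)%N.
  by rewrite -prime_coprime // coprimeMr coprimeXr.
have dz (a : int) : (q %| `|a|)%N = (a \in dvdz q%:Z) by [].
rewrite prime_coprime //; elim: m => [|m IH].
  rewrite (_ : crit_num 0 = q%:Z - (n ^ (3 + j) * p * n.-1 ^ n.-1)%:Z) //.
  rewrite dz rpredBl ?dvdzz // -dz absz_nat.
  by rewrite -prime_coprime // 2!coprimeMr qp (coprimeXr _ qn) (coprimeXr _ qn1).
have qe k : (q%:Z %| (q ^ edeg k.+1)%:Z)%Z by rewrite dvdzE /= dvdn_exp.
have -> : crit_num m.+1 = (n ^ (n + 3 + j) * p)%:Z * crit_num m *
  (crit_num m - (q ^ edeg m.+1)%:Z) ^+ n.-1 + (q ^ edeg m.+2)%:Z by [].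
rewrite dz rpredDr ?qe // -dz !abszM abszX absz_nat.
rewrite 2?Euclid_dvdM // (negPf (qD _)) (negPf IH) /= Euclid_dvdX //.
by apply/negP => /andP[]; rewrite dz rpredBr ?qe // -dz (negPf IH).
Qed.

(** Were all exponents even, |N| would be a square, hence 0, 1 or 4 modulo 8; but N is congruent to
    q, which leaves only 3 or 5 for |N|. *)
Lemma crit_prime m : exists l,
  [/\ prime l, coprime l n, coprime l p, coprime l q & odd (logn l `|crit_num m|)].
Proof.
have [t tE] := crit_num_mod m; have cq := crit_num_coprime_q m.
have N0 : (0 < `|crit_num m|)%N.
  rewrite lt0n; apply: contraTneq cq => ->; rewrite /coprime gcdn0.
  by rewrite gtn_eqF ?prime_gt1.
have qe8 : (q ^ edeg m.+1 = q %[mod 8])%N.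
  rewrite -(odd_double_half (edeg m.+1)) odd_edeg add1n expnS -muln2 mulnC expnM.
  have /eqP q2 : (q ^ 2 %% 8 == 1)%N.
    by rewrite -modnXm; move: q_mod8; rewrite !inE => /orP[] /eqP->.
  by rewrite expnAC -modnMml -modnXm q2 exp1n mul1n.
have [s sE] : exists s, (q ^ edeg m.+1)%N = (q + 8 * s)%N.
  exists ((q ^ edeg m.+1 - q) %/ 8)%N.
  have : (q <= q ^ edeg m.+1)%N by rewrite -{1}(expn1 q) leq_exp2l ?prime_gt1.
  lia.
have [w wE] : exists w, (n ^ (3 + j) * p)%N = (8 * w)%N.
  exists (n./2 ^ 3 * n ^ j * p)%N; rewrite !mulnA expnD; congr (_ * _ * _)%N.
  have nE : n = (n./2 * 2)%N by rewrite muln2 -[LHS]odd_double_half (negPf n_even).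
  by rewrite {1}nE expnMn; nia.
have [/allP ev|/allPn[l]] := 
  boolP (all (fun l => ~~ odd (logn l `|crit_num m|)) (primes `|crit_num m|)).
  have [l l_pr|y yE] := even_logn_square N0.
    have [/ev//|] := boolP (l \in primes `|crit_num m|).
    by rewrite -logn_gt0 -eqn0Ngt => /eqP->.
  have y8 : (y ^ 2 %% 8 \in [:: 0; 1; 4])%N.
    rewrite -modnXm; have := ltn_pmod y (isT : (0 < 8)%N).
    by case: (y %% 8)%N; do 9?[case=> //].
  rewrite sE wE PoszM in tE; move: q_mod8 y8 yE; rewrite !inE.
  move: tE (y ^ 2)%N; rewrite -mulrA; move: (_ * t) (crit_num m) => a b; lia.
rewrite mem_primes negbK => /and3P[l_pr _ lN] oddl; exists l.
have lq : coprime l q.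
  rewrite prime_coprime // dvdn_prime2 //; apply: contraTneq cq => <-.
  by rewrite prime_coprime ?lN.
(* By [crit_num_mod] a prime dividing both N and n^(3+j) p would divide a power of q. *)
have lD : ~~ (l %| n ^ (3 + j) * p)%N.
  apply: contraL lq => lD; rewrite prime_coprime // negbK.
  have : (l%:Z %| (q ^ edeg m.+1)%:Z)%Z.
    rewrite (_ : (q ^ _)%:Z = crit_num m - (n ^ (3 + j) * p)%:Z * t).
      by rewrite rpredB // dvdz_mulr.
    by rewrite tE addrK.
  by rewrite dvdzE /= Euclid_dvdX // => /andP[].
move: lD; rewrite -prime_coprime // coprimeMr coprime_pexpr // => /andP[ln lp].
by split.
Qed.

End CriticalOrbit.

Local Open Scope ring_scope.

Local Notation autC := {rmorphism algC -> algC}.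
Local Notation QC := (ratr : {rmorphism rat -> algC}).

(** * Valuation rings of algC *)

(** A place of [algC] above p, encoded by its valuation ring. No value group is introduced:
    valuations are compared by asking whether quotients lie in the ring or are units. *)
Record valring (p : nat) := Valring {
  vr :> {pred algC};
  vr_subring : subring_closed vr;
  vr_val : forall x, x \notin vr -> x^-1 \in vr;
  vr_prime : p%:R^-1 \notin vr }.

HB.instance Definition _ p (v : valring p) :=
  GRing.isSubringClosed.Build algC (vr v) (vr_subring v).

Definition vmax p (v : valring p) : {pred algC} :=
  [pred x | (x == 0) || (x^-1 \notin v)].
Definition vunit p (v : valring p) : {pred algC} :=
  [pred x | [&& x != 0, x \in v & x^-1 \in v]].

Section ValuationRing.
Variables (p : nat) (v : valring p).
Local Notation m := (vmax v).
Local Notation u := (vunit v).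
Implicit Types x y : algC.

Lemma vmaxE x : (x \in m) = (x == 0) || (x^-1 \notin v).
Proof. by []. Qed.

Lemma vunitE x : (x \in u) = (x \in v) && (x \notin m).
Proof.
by rewrite vmaxE negb_or negbK !inE; case: eqP; case: (x \in v); case: (_ \in v).
Qed.

Lemma vmax_vr x : x \in m -> x \in v.
Proof.
rewrite vmaxE => /orP[/eqP->|]; first exact: rpred0.
by move/vr_val; rewrite invrK.
Qed.

Lemma vunit_vr x : x \in u -> x \in v.
Proof. by case/and3P. Qed.

Lemma vunit_neq0 x : x \in u -> x != 0.
Proof. by case/and3P. Qed.

Lemma vunit_vmax x : x \in u -> x \in m -> False.
Proof. by rewrite vunitE => /andP[_ /negP]. Qed.

Lemma vmaxMl x y : x \in v -> y \in m -> x * y \in m.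
Proof.
move=> vx; rewrite !vmaxE => /orP[/eqP->|ny]; first by rewrite mulr0 eqxx.
have [//|nz] := boolP (x * y == 0); move: nz; rewrite mulf_eq0 negb_or => /andP[x0 y0].
apply: contra ny => vxy; have -> : y^-1 = x * (x * y)^-1.
  by rewrite invfM mulrA divff ?mul1r.
exact: rpredM.
Qed.

Lemma vmaxMr x y : x \in m -> y \in v -> x * y \in m.
Proof. by move=> mx vy; rewrite mulrC vmaxMl. Qed.

Lemma vmax_zmod : zmod_closed m.
Proof.
split=> [|x y]; first by rewrite vmaxE eqxx.
have [->|x0] := eqVneq x 0.
  by move=> _ my; rewrite sub0r -mulN1r; apply: vmaxMl; rewrite ?rpredN1.
move=> mx my; have [->|y0] := eqVneq y 0; first by rewrite subr0.
have [vxy|] := boolP (x / y \in v).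
  have -> : x - y = (x / y - 1) * y by rewrite mulrBl divfK ?mul1r.
  by rewrite vmaxMl // rpredB // rpred1.
move/vr_val; rewrite invf_div => vyx.
have -> : x - y = (1 - y / x) * x by rewrite mulrBl divfK ?mul1r.
by rewrite vmaxMl // rpredB // rpred1.
Qed.
HB.instance Definition _ := GRing.isZmodClosed.Build algC (vmax v) vmax_zmod.

Lemma one_notin_vmax : 1 \notin m.
Proof. by rewrite vmaxE oner_eq0 invr1 rpred1. Qed.

Lemma vunit_divr : divr_closed u.
Proof.
split=> [|x y /and3P[x0 vx vx'] /and3P[y0 vy vy']].
  by rewrite inE oner_eq0 invr1 rpred1.
by rewrite inE mulf_neq0 ?invr_neq0 ?invf_div // !rpredM.
Qed.
HB.instance Definition _ := GRing.isDivClosed.Build algC (vunit v) vunit_divr.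

Lemma vmaxM x y : x \in v -> y \in v -> x * y \in m -> (x \in m) || (y \in m).
Proof.
move=> vx vy mxy; apply: contraLR mxy; rewrite negb_or => /andP[mx my].
have ux : x \in u by rewrite vunitE vx.
have uy : y \in u by rewrite vunitE vy.
by have : x * y \in u by [exact: rpredM]; rewrite vunitE => /andP[].
Qed.

Lemma vmaxX x k : x \in v -> x ^+ k \in m -> x \in m.
Proof.
move=> vx; elim: k => [|k IH]; first by rewrite expr0 (negPf one_notin_vmax).
by rewrite exprS => /(vmaxM vx (rpredX k vx))/orP[//|/IH].
Qed.

Lemma vmax_prod (I : eqType) (s : seq I) (P : pred I) (F : I -> algC) :
  (forall i, i \in s -> P i -> F i \in v) -> \prod_(i <- s | P i) F i \in m ->
  exists2 i, (i \in s) && P i & F i \in m.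
Proof.
elim: s => [|i s IH] vF; first by rewrite big_nil (negPf one_notin_vmax).
have vs j : j \in s -> P j -> F j \in v by move=> sj; apply: vF; rewrite inE sj orbT.
rewrite big_cons; case: ifP => [Pi|_] mF; last first.
  have [j /andP[sj Pj] mj] := IH vs mF.
  by exists j; rewrite // inE sj orbT.
have vP : \prod_(j <- s | P j) F j \in v.
  by rewrite big_seq_cond rpred_prod // => j /andP[]; apply: vs.
have /orP[] := vmaxM (vF i (mem_head _ _) Pi) vP mF.
- by move=> mi; exists i; rewrite // inE eqxx.
- move=> ms; have [j /andP[sj Pj] mj] := IH vs ms.
  by exists j; rewrite // inE sj orbT.
Qed.

Lemma vunitDm x y : x \in u -> y \in m -> x + y \in u.
Proof.
move=> ux my; rewrite vunitE rpredD ?(vunit_vr ux) ?(vmax_vr my) //=.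
apply/negP => mxy; apply: (vunit_vmax ux).
by rewrite -(addrK y x) rpredB.
Qed.

Lemma vunitN x : (- x \in u) = (x \in u).
Proof. by rewrite !inE oppr_eq0 invrN !rpredN. Qed.

Lemma vr_inv_vmax x : x \notin v -> x^-1 \in m.
Proof. by rewrite vmaxE invrK => ->; rewrite orbT. Qed.

Lemma vr_root x k : (0 < k)%N -> x ^+ k \in v -> x \in v.
Proof.
move=> k0 vxk; apply: contraT => nvx; have mx := vr_inv_vmax nvx.
have x0 : x != 0 by apply: contraNneq nvx => ->; rewrite rpred0.
have : x ^+ k * x^-1 ^+ k \in m.
  by case: k k0 vxk => // k _ vxk; rewrite vmaxMl // exprS vmaxMr // rpredX // vmax_vr.
by rewrite -exprMn divff // expr1n (negPf one_notin_vmax).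
Qed.

Hypothesis p_pr : prime p.

Lemma vmax_prime : p%:R \in m.
Proof. by rewrite vmaxE vr_prime orbT. Qed.

Lemma vunit_coprime (a : nat) : coprime p a -> a%:R \in u.
Proof.
move=> pa; have a_gt0 : (0 < a)%N.
  by rewrite lt0n; apply: contraL pa => /eqP->; rewrite /coprime gcdn0 gtn_eqF ?prime_gt1.
rewrite vunitE rpred_nat /=; apply/negP => ma.
have [c d cd _] := egcdnP p a_gt0.
move: cd; rewrite gcdnC (eqP pa) => /(congr1 (fun t => t%:R : algC)); rewrite natrD !natrM => E.
have : 1%:R \in m.
  rewrite -[X in X \in _](addKr (d%:R * p%:R)) -E rpredD ?rpredN //.
    by apply: vmaxMl; rewrite ?rpred_nat ?vmax_prime.
  by apply: vmaxMl; rewrite ?rpred_nat.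
by rewrite (negPf one_notin_vmax).
Qed.

Lemma vunit_coprimez (a : int) : coprime p `|a| -> a%:~R \in u.
Proof.
move=> /vunit_coprime; rewrite {2}[a]intEsign rmorphM rmorph_sign /= -pmulrn.
by case: (_ < _); rewrite ?mulN1r ?vunitN ?mul1r.
Qed.

(** Discreteness over the rationals: a positive valuation is at least that of p, since integers
    prime to p are units and p must divide the reduced numerator. *)
Lemma vmax_rat x : x \in Crat -> x \in m -> x / p%:R \in v.
Proof.
case/CratP => r ->{x}; rewrite /ratr => mr.
have den0 : (denq r)%:~R != 0 :> algC by rewrite intr_eq0 denq_neq0.
have mn : (numq r)%:~R \in m by rewrite -(divfK den0 (numq r)%:~R) vmaxMr ?rpred_int.
have pn : (p %| `|numq r|)%N.
  apply: contraT; rewrite -prime_coprime // => /vunit_coprimez /vunit_vmax.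
  by case/(_ mn).
have pd : coprime p `|denq r|.
  rewrite prime_coprime //; apply/negP => pd.
  have : (p %| gcdn `|numq r| `|denq r|)%N by rewrite dvdn_gcd pn.
  by rewrite (eqP (coprime_num_den r)) dvdn1 => /eqP p1; move: p_pr; rewrite p1.
have [k kE] := dvdnP pn.
have -> : (numq r)%:~R / (denq r)%:~R / p%:R =
    (-1) ^+ (numq r < 0)%R * k%:R * ((denq r)%:~R)^-1 :> algC.
  rewrite {1}[numq r]intEsign kE rmorphM rmorph_sign /= -pmulrn natrM.
  have p0 : p%:R != 0 :> algC by rewrite pnatr_eq0 -lt0n prime_gt0.
  by rewrite mulrAC; congr (_ / _); rewrite -!mulrA divff // mulr1.
rewrite rpredM ?rpredM ?rpred_nat ?rpred_sign //.
by rewrite vunit_vr // rpredV vunit_coprimez.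
Qed.

Lemma rat_prime_unit x : x \in Crat -> x != 0 -> exists k : int, x / p%:R ^ k \in u.
Proof.
case/CratP => r ->{x}; rewrite fmorph_eq0 => r0.
have p0 : p%:R != 0 :> algC by rewrite pnatr_eq0 -lt0n prime_gt0.
have natP (a : nat) : (0 < a)%N -> a%:R / p%:R ^+ logn p a \in u.
  move=> a0; rewrite {1}[a](_ : _ = (p ^ logn p a * a`_p^')%N).
    rewrite natrM natrX mulrAC divff ?expf_neq0 // mul1r vunit_coprime //.
    rewrite prime_coprime // -p'natE //; exact: part_pnat.
  by rewrite -p_part partnC.
have nn : (0 < `|numq r|)%N by rewrite absz_gt0 numq_eq0.
have dn : (0 < `|denq r|)%N by rewrite absz_gt0 denq_eq0.
exists ((logn p `|numq r|)%:Z - (logn p `|denq r|)%:Z).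
rewrite expfzDr // -exprnN -exprnP.
have -> : ratr r = (-1) ^+ (numq r < 0)%R * `|numq r|%:R / `|denq r|%:R :> algC.
  rewrite /ratr {1}[numq r]intEsign rmorphM rmorph_sign /= -pmulrn; congr (_ * _ / _).
  by rewrite -{1}[denq r]gez0_abs ?denq_ge0 // -pmulrn.
set a := `|numq r|%N; set d := `|denq r|%N.
have -> : (-1) ^+ (numq r < 0)%R * a%:R / d%:R / (p%:R ^+ logn p a * p%:R ^- logn p d)
   = (-1) ^+ (numq r < 0)%R * ((a%:R / p%:R ^+ logn p a) / (d%:R / p%:R ^+ logn p d)) :> algC.
  rewrite !invfM !invrK -!mulrA; congr (_ * (_ * _)).
  by rewrite mulrCA.
apply: rpredM; last by apply: rpred_div; apply: natP.
by case: (numq r < 0); rewrite ?expr1 ?vunitN rpred1.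
Qed.

End ValuationRing.

(** If the minimal polynomial has a root y other than x, the map sending x to y extends to a number
    field containing all the roots and then to [algC]. Otherwise x is its only root, and a simple
    one, so the polynomial is linear. *)
Lemma aut_fixed_rat (x : algC) :
  (forall nu : {rmorphism algC -> algC}, nu x = x) -> x \in Crat.
Proof.
move=> fixx; have [p [Dp mon_p] dv_p] := minCpolyP x.
have px : root (map_poly ratr p) x by rewrite dv_p dvdpp.
have [r Dr] := closed_field_poly_normal (map_poly ratr p : {poly algC}).
rewrite lead_coef_map (monicP mon_p) rmorph1 scale1r in Dr.
have szr : size r = (size p).-1.
  by rewrite -(size_map_poly (ratr : {rmorphism rat -> algC})) Dr size_prod_XsubC.
have xr : x \in r by rewrite -root_prod_XsubC -Dr.
(* The derivative is nonzero of smaller degree than the minimal polynomial, so x is a simple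
   root. *)
have nr' : ~~ root (map_poly ratr p^`()) x.
  have p1 : (1 < size p)%N.
    by rewrite -(size_map_poly (ratr : {rmorphism rat -> algC})) -Dp size_minCpoly.
  have d0 : p^`() != 0.
    apply/eqP => /polyP/(_ (size p).-2); rewrite coef_deriv coef0.
    move: (monicP mon_p); rewrite lead_coefE.
    by case: (size p) p1 => [|[|k]] //= _ -> /eqP; rewrite pnatr_eq0.
  rewrite dv_p; apply/negP => /(dvdp_leq d0).
  by rewrite leqNgt lt_size_deriv // monic_neq0.
have [/hasP[y yr nyx]|/hasPn allx] := boolP (has (predC1 x) r).
  have [Qr [QrC [rr Drr genQr]]] := num_field_exists r.
  have [zz Dz] : exists zz, QrC zz = x.
    by move: xr; rewrite -Drr => /mapP[z _ ->]; exists z.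
  have [yy Dy] : exists yy, QrC yy = y.
    by move: yr; rewrite -Drr => /mapP[z _ ->]; exists z.
  pose pr := map_poly (in_alg Qr) p.
  have Dpr : map_poly QrC pr = map_poly ratr p.
    rewrite -map_poly_comp; apply: eq_map_poly => a.
    by rewrite /= rmorphZ_num rmorph1 mulr1.
  have Qpr : pr \is a polyOver 1%VS.
    by apply/polyOverP=> i; rewrite coef_map memvZ ?memv_line.
  have homQr1 : kHom 1 1 (\1%VF : 'End(Qr)) by rewrite kHom1.
  have rzy : root (map_poly \1%VF (minPoly 1 zz)) yy.
    rewrite -(fmorph_root QrC) /= Dy -map_poly_comp.
    rewrite (@eq_map_poly _ _ _ QrC) => [|a]; last by rewrite /= id_lfunE.
    set p1 := map_poly _ _.
    have [q1 Dp1]: exists q1, p1 = map_poly ratr q1.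
      have aP i: (minPoly 1 zz)`_i \in 1%VS.
        by apply/polyOverP; apply: minPolyOver.
      have{aP} a_ i := sig_eqW (vlineP _ _ (aP i)).
      exists (\poly_(i < size (minPoly 1 zz)) sval (a_ i)).
      apply/polyP=> i; rewrite coef_poly coef_map coef_poly /=.
      case: ifP => _; rewrite ?rmorph0 //; case: (a_ i) => a /= ->.
      by rewrite alg_num_field fmorph_rat.
    have: root p1 x by rewrite -Dz fmorph_root root_minPoly.
    rewrite Dp1 dv_p => /dvdpP[r1 ->]; rewrite rmorphM rootM /= Dr root_prod_XsubC yr.
    by rewrite orbT.
  have hom := kHomExtendP (sub1v _) homQr1 rzy.
  have splitQr : splittingFieldFor <<1; zz>>%AS pr fullv.
    apply: splittingFieldForS (sub1v _) (subvf _) _; exists rr => //.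
    congr (_ %= _): (eqpxx pr); apply/(map_poly_inj QrC).
    rewrite Dpr Dr -Drr big_map rmorph_prod /=; apply: eq_bigr => ? _.
    by rewrite map_polyXsubC.
  have [f1 aut_f1 Df1] := kHom_extends (sub1v _) hom Qpr splitQr.
  pose f1mM := GRing.isMonoidMorphism.Build _ _ f1 (kHom_monoid_morphism aut_f1).
  pose phi : {rmorphism _ -> _} := HB.pack (fun_of_lfun f1) f1mM.
  have [nu Dnu] := extend_algC_subfield_aut QrC phi.
  have : nu x = y.
    rewrite -Dz -Dnu /= -Df1 ?memv_adjoin // (kHomExtend_val homQr1) //.
  by rewrite fixx => xy; rewrite /= xy eqxx in nyx.
have allx' y : y \in r -> y = x by move/allx; rewrite /= negbK => /eqP.
case: r Dr szr xr allx' {allx} => [|a [|b r]] // Dr szr _ allx.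
  move/polyP/(_ 0%N): Dr; rewrite coef_map big_seq1 coefB coefX coefC /= sub0r.
  rewrite (allx a) ?inE // => /(congr1 -%R); rewrite opprK => <-.
  by rewrite rpredN Crat_rat.
case/negP: nr'; rewrite -deriv_map Dr !big_cons (allx a) ?inE ?eqxx //.
rewrite (allx b) ?inE ?eqxx ?orbT // !derivM !derivXsubC rootE !hornerE.
by rewrite subrr !(mul0r, mulr0, addr0).
Qed.

(* Take a subring maximal among those not containing 1/p.  Then 1 - p r is always
   invertible, which lets relations 1/p = a(x) and 1/p = b(1/x) lower each
   other's degree until they contradict the choice of the subring. *)
Lemma valring_exists p : prime p -> exists v : valring p, True.
Proof.
move=> p_pr; pose pi : algC := p%:R^-1.
have p0 : p%:R != 0 :> algC by rewrite pnatr_eq0 -lt0n prime_gt0.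
(* The conditional form of containing 1 admits the empty set, which is the union of the empty
   chain. *)
pose P (A : set algC) := [/\ forall x, A x -> A 1,
  forall x y, A x -> A y -> A (x - y), forall x y, A x -> A y -> A (x * y) & ~ A pi].
have [F subF totF|A [[PA1 AB AM Api] maxA]] := @Zorn_bigcup _ P.
  split=> [x [A FA Ax]|x y [A FA Ax] [B FB By]|x y [A FA Ax] [B FB By]|[A FA]].
  - by exists A => //; have [PA _ _ _] := subF _ FA; apply: PA Ax.
  - case: (totF _ _ FA FB) => [AB|BA].
      by exists B => //; have [_ PB _ _] := subF _ FB; apply: PB => //; apply: AB.
    by exists A => //; have [_ PB _ _] := subF _ FA; apply: PB => //; apply: BA.
  - case: (totF _ _ FA FB) => [AB|BA].
      by exists B => //; have [_ _ PB _] := subF _ FB; apply: PB => //; apply: AB.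
    by exists A => //; have [_ _ PB _] := subF _ FA; apply: PB => //; apply: BA.
  - by have [_ _ _] := subF _ FA.
(* Without 1 the set [A] would be empty, and the ring of integers would be strictly larger. *)
have A1 : A 1.
  apply: contrapT => nA1; have nA x : ~ A x by move/PA1.
  apply: (maxA [set x : algC | x \in Num.int]%classic).
    split=> [x /nA //|BA]; apply: (nA 1).
    by apply: BA; rewrite /= rpred1.
  split=> /= [x _|x y|x y|]; [exact: rpred1 | exact: rpredB | exact: rpredM |].
  case/intrP => k kE; have : (p%:Z * k)%:~R = 1 :> algC by rewrite rmorphM /= -kE divff.
  rewrite -[1]/(1%:~R) => /intr_inj /(congr1 absz); rewrite abszM /= => /eqP.
  by rewrite muln_eq1 => /andP[/eqP p1]; rewrite p1 in p_pr.
have A0 : A 0 by rewrite -(subrr 1); apply: AB.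
have AN x : A x -> A (- x) by move=> Ax; rewrite -sub0r; apply: AB.
have AD x y : A x -> A y -> A (x + y).
  by move=> Ax Ay; rewrite -[y]opprK; apply: AB => //; apply: AN.
have AX x k : A x -> A (x ^+ k).
  by move=> Ax; elim: k => [|k IH]; rewrite ?expr0 // exprS; apply: AM.
have Asum (I : Type) (s : seq I) (G : I -> algC) : (forall i, A (G i)) -> A (\sum_(i <- s) G i).
  by move=> AG; apply: big_ind.
have Ap : A p%:R by elim: (p) => [|k IH]; rewrite ?mulrS //; apply: AD.
pose Apoly (q : {poly algC}) := forall i, A q`_i.
(* Adjoining y gives a strictly larger ring, which by maximality contains 1/p. *)
have adj y : ~ A y -> exists2 q, Apoly q & q.[y] = pi.
  move=> nAy; pose B := [set x | exists2 q, Apoly q & q.[y] = x]%classic.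
  apply: contrapT => nB; apply: (maxA B).
    split=> [x Ax|/(_ y) AB'].
      exists x%:P; last by rewrite hornerC.
      by move=> i; rewrite coefC; case: ifP.
    apply/nAy/AB'; exists 'X; last by rewrite hornerX.
    by move=> i; rewrite coefX; case: eqP.
  split=> // [x _|_ _ [q Aq <-] [r Ar <-]|_ _ [q Aq <-] [r Ar <-]].
  - by exists 1; rewrite ?hornerE // => i; rewrite coef1; case: eqP.
  - by exists (q - r); rewrite ?hornerE // => i; rewrite coefB; apply: AB.
  - exists (q * r); rewrite ?hornerE // => i; rewrite coefM.
    by apply: Asum => j; apply: AM.
(* If 1/p = q(1/z) with z = 1 - p r, then z^N / p lies in [A] for N = [size q], and so does (z^N -
   1) / p; their difference is 1/p. *)
have Aunit r : A r -> A (1 - p%:R * r)^-1.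
  move=> Ar; set z := 1 - _; apply: contrapT => /adj[q Aq qE].
  have Az : A z by apply: AB => //; apply: AM.
  have z0 : z != 0.
    apply/eqP => /eqP; rewrite subr_eq0 => /eqP E; apply: Api.
    by have -> : pi = r by apply: (mulfI p0); rewrite -E mulfV.
  have Azs k : A ((z ^+ k - 1) / p%:R).
    rewrite subrX1 (_ : z - 1 = - r * p%:R); last first.
      by rewrite /z addrAC subrr add0r mulNr mulrC.
    rewrite mulrAC mulfK //; apply: AM; first exact: AN.
    by apply: Asum => i; apply: AX.
  apply: Api; have -> : pi = z ^+ size q * q.[z^-1] - (z ^+ size q - 1) / p%:R.
    by rewrite qE -mulrBl opprB addrCA subrr addr0 mul1r.
  apply: AB => //; rewrite horner_coef mulr_sumr; apply: Asum => i.
  rewrite mulrCA; apply: AM => //.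
  have -> : z ^+ size q = z ^+ (size q - i) * z ^+ i by rewrite -exprD subnK // ltnW.
  by rewrite -mulrA -exprMn divff // expr1n mulr1; apply: AX.
have noboth N x (q r : {poly algC}) : (size q + size r <= N)%N -> Apoly q -> Apoly r ->
  q.[x] = pi -> r.[x^-1] = pi -> False.
  elim: N x q r => [|N IH] x q r.
    rewrite leqn0 addn_eq0 !size_poly_eq0 => /andP[/eqP-> _].
    by rewrite horner0 => _ _ /esym/eqP; rewrite invr_eq0 (negPf p0).
  wlog lerq : x q r / (size r <= size q)%N.
    move=> wl; have [|/ltnW] := leqP (size r) (size q); first exact: wl.
    move=> le szqr Aq Ar qx rx; apply: (wl x^-1 r q) => //; first by rewrite addnC.
    by rewrite invrK.
  move=> szqr Aq Ar qx rx.
  have szq : (0 < size q)%N.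
    rewrite lt0n size_poly_eq0; apply/eqP => q0; move: qx.
    by rewrite q0 horner0 => /esym/eqP; rewrite invr_eq0 (negPf p0).
  have szr : (0 < size r)%N.
    rewrite lt0n size_poly_eq0; apply/eqP => q0; move: rx.
    by rewrite q0 horner0 => /esym/eqP; rewrite invr_eq0 (negPf p0).
  have z0 : 1 - p%:R * r`_0 != 0.
    apply/eqP => /eqP; rewrite subr_eq0 => /eqP E; apply: Api.
    by have -> : pi = r`_0 by apply: (mulfI p0); rewrite -E mulfV.
  have x0 : x != 0.
    apply/eqP => x0; apply: Api; move: qx; rewrite x0 horner_coef0 => <-; exact: Aq.
  case: (size q) szq szqr lerq (horner_coef q x) => // k _ szqr lerq qE.
  pose w := (1 - p%:R * r`_0)^-1; have Aw : A w by apply: Aunit.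
  (* The relation for 1/x gives 1 = p w (sum over j >= 1 of r_j x^-j); multiplying q_k x^k by it
     removes the top term of q. Exponents stay nonnegative because r is no longer than q. *)
  pose q' := \poly_(i < k) q`_i + \sum_(1 <= j < size r) (p%:R * w * r`_j * q`_k) *: 'X^(k - j).
  apply: (IH x q' r) => //.
  - apply: leq_trans (_ : (k + size r <= N)%N); last by rewrite addSn ltnS in szqr.
    rewrite leq_add2r (leq_trans (size_polyD _ _)) // geq_max size_poly /=.
    apply: (leq_trans (size_sum _ _ _)); apply/bigmax_leqP_seq => j.
    rewrite mem_index_iota => /andP[j1 jr] _; apply: leq_trans (size_scale_leq _ _) _.
    rewrite size_polyXn ltn_subrL j1 /= -ltnS.
    exact: leq_trans (leq_ltn_trans j1 jr) lerq.
  - move=> i; rewrite coefD coef_poly coef_sum; apply: AD; first by case: ifP.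
    apply: Asum => j; rewrite coefZ; apply: (AM); first by do 3!apply: (AM) => //.
    by rewrite coefXn; case: eqP.
  - rewrite hornerD horner_poly -qx qE big_ord_recr /=; congr (_ + _).
    rewrite horner_sum; under eq_bigr do rewrite hornerZ hornerXn.
    have {1}-> : q`_k * x ^+ k = q`_k * x ^+ k *
        (p%:R * w * (\sum_(1 <= j < size r) r`_j * x^-1 ^+ j)).
      rewrite -[LHS]mulr1; congr (_ * _); apply: (mulfI z0).
      set S := \sum_(_ <= _ < _) _; set z := 1 - _ in z0 *.
      rewrite mulr1 (_ : z * (p%:R * w * S) = z * w * (p%:R * S)); last by ring.
      rewrite mulfV // mul1r /S /z.
      move: rx; rewrite horner_coef -(big_mkord predT (fun j => r`_j * x^-1 ^+ j)).
      rewrite big_ltn // expr0 mulr1 => /(congr1 ( *%R p%:R)); rewrite mulfV // mulrDr => E.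
      by apply/eqP; rewrite subr_eq addrC E.
    rewrite !mulr_sumr; apply: eq_big_nat => j /andP[j1 jr].
    have jk : (j <= k)%N by rewrite -ltnS (leq_trans jr lerq).
    have -> : x ^+ k = x ^+ (k - j) * x ^+ j by rewrite -exprD subnK.
    have xx : x ^+ j * x^-1 ^+ j = 1 by rewrite -exprMn divff // expr1n.
    rewrite -[LHS]mulr1 -xx; ring.
have memA x : (x \in [pred x | `[<A x>]]) = `[<A x>] by [].
have sub : subring_closed [pred x | `[<A x>]].
  split=> [|x y|x y]; rewrite !memA; first exact/asboolP.
    by move=> /asboolP ? /asboolP ?; apply/asboolP; apply: AB.
  by move=> /asboolP ? /asboolP ?; apply/asboolP; apply: AM.
have val x : x \notin [pred x | `[<A x>]] -> x^-1 \in [pred x | `[<A x>]].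
  rewrite !memA => /asboolP /adj[q Aq qx]; apply/asboolP; apply: contrapT => /adj[r Ar rx].
  exact: (noboth _ x q r (leqnn _)).
by exists (@Valring p _ sub val (introN (asboolP _) Api)).
Qed.

(** * Inertia *)

(* Dedekind's independence of characters, for ring morphisms that are pairwise
   distinct modulo the maximal ideal. *)
Lemma independence_mod p (v : valring p) (X : algC -> Prop) (I : eqType)
    (phi : I -> algC -> algC) (s : seq I) (c : I -> algC) :
  X 1 -> (forall x y, X x -> X y -> X (x * y)) ->
  (forall i x, X x -> phi i x \in v) -> (forall i, phi i 1 = 1) ->
  (forall i x y, phi i (x * y) = phi i x * phi i y) -> uniq s ->
  (forall i j, i \in s -> j \in s -> i != j ->
     exists2 x, X x & phi i x - phi j x \notin vmax v) ->
  (forall i, c i \in v) ->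
  (forall x, X x -> \sum_(i <- s) c i * phi i x \in vmax v) ->
  forall i, i \in s -> c i \in vmax v.
Proof.
move=> X1 XM vphi phi1 phiM.
elim: s c => [|a s IH] c //= /andP[nas uniqs] dist vc sum0 i.
have cs j : j \in s -> c j \in vmax v.
  move=> js; have [|||x Xx nx] := dist a j; rewrite ?inE ?eqxx ?js ?orbT //.
    by apply: contraNneq nas => ->.
  (* Subtracting phi_a(x) times the relation at y from the relation at x y eliminates the term of
     a. *)
  have : c j * (phi j x - phi a x) \in vmax v.
    apply: (IH (fun j => c j * (phi j x - phi a x))) => //.
    - by move=> k l ks ls; apply: dist; rewrite inE ?ks ?ls orbT.
    - by move=> k; rewrite rpredM ?rpredB ?vphi.
    - move=> y Xy; have := sum0 _ (XM _ _ Xx Xy); have := sum0 _ Xy.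
      rewrite !big_cons => /(vmaxMl (vphi a x Xx)) S1 S2.
      suff -> : \sum_(k <- s) c k * (phi k x - phi a x) * phi k y =
        c a * phi a (x * y) + \sum_(k <- s) c k * phi k (x * y)
        - phi a x * (c a * phi a y + \sum_(k <- s) c k * phi k y) by exact: rpredB.
      rewrite phiM mulrDr mulr_sumr opprD addrACA mulrCA subrr add0r -sumrB.
      by apply: eq_bigr => k _; rewrite phiM; ring.
  case/vmaxM/orP => //; first by rewrite rpredB ?vphi.
  by rewrite -opprB rpredN (negPf nx).
rewrite inE => /orP[/eqP->|/cs//].
have := sum0 _ X1; rewrite big_cons phi1 mulr1 => S1.
have S2 : \sum_(j <- s) c j * phi j 1 \in vmax v.
  by rewrite big_seq rpred_sum // => j /cs cj; rewrite phi1 mulr1.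
by have := rpredB S1 S2; rewrite addrK.
Qed.

Section FiniteConjugates.
Variables (M : nat) (r : 'I_M -> algC).
Hypotheses (r_inj : injective r) (r_aut : forall (nu : autC) i, exists j, nu (r i) = r j).

Lemma aut_perm (nu : autC) : exists s : 'S_M, forall i, nu (r i) = r (s i).
Proof.
have [f fE] := choice (r_aut nu).
have f_inj : injective f by move=> i j /(congr1 r); rewrite -!fE => /fmorph_inj/r_inj.
by exists (perm f_inj) => i; rewrite permE.
Qed.

(* If inertia were trivial, the automorphisms nu_s would be distinct modulo the
   maximal ideal, but sum_s (nu_s delta / delta) nu_s x is a rational number
   divided by delta, hence has positive valuation because v(delta^2) is odd. *)
Lemma inertia_neq1 l (v : valring l) (delta u : algC) : prime l ->
  (forall i, r i \in v) -> delta ^+ 2 = l%:R * u -> u \in vunit v -> delta ^+ 2 \in Crat ->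
  (forall nu : autC, (forall i, nu (r i) = r i) -> nu delta = delta) ->
  exists nu : autC, (exists i, nu (r i) != r i) /\ forall i, nu (r i) - r i \in vmax v.
Proof.
move=> l_pr vr dE uu dQ dfix; apply: contrapT => noI.
have trivI (nu : autC) : (forall i, nu (r i) - r i \in vmax v) -> forall i, nu (r i) = r i.
  move=> inu i; apply/eqP; apply: contra_notT noI => ni.
  by exists nu; split=> //; exists i.
have l0 : l%:R != 0 :> algC by rewrite pnatr_eq0 -lt0n prime_gt0.
have d0 : delta != 0.
  by rewrite -sqrf_eq0 dE mulf_neq0 // (vunit_neq0 uu).
pose G (s : 'S_M) := exists nu : autC, forall i, nu (r i) = r (s i).
have /choice[N NE] s : exists nu : autC, G s -> forall i, nu (r i) = r (s i).
  have [[nu nuE]|ng] := pselect (G s); first by exists nu.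
  by exists idfun.
(* [Rdet] is membership in the field generated by the [r i], phrased through automorphisms; [X]
   below adds integrality of all conjugates. *)
pose Rdet x := forall nu mu : autC, (forall i, nu (r i) = mu (r i)) -> nu x = mu x.
have Rd : Rdet delta.
  move=> nu mu E; apply: (fmorph_inj (algC_invaut mu)); rewrite /= algC_autK.
  by apply: (dfix (algC_invaut mu \o nu : autC)) => i; rewrite /= E algC_autK.
pose X x := (forall nu : autC, nu x \in v) /\ Rdet x.
have Xr i : X (r i).
  by split=> [nu|nu mu E //]; have [j ->] := r_aut nu i.
have X1 : X 1 by split=> [nu|nu mu _]; rewrite !rmorph1 // rpred1.
have XM x y : X x -> X y -> X (x * y).
  move=> [vx dx] [vy dy]; split=> [nu|nu mu E]; rewrite !rmorphM ?rpredM //.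
  by rewrite (dx _ _ E) (dy _ _ E).
pose sq := [seq s <- index_enum 'S_M | `[<G s>]].
have sgn (nu : autC) : nu delta / delta \in vunit v.
  have /eqP : (nu delta) ^+ 2 = delta ^+ 2 by rewrite -rmorphXn /= (aut_Crat nu dQ).
  by rewrite eqf_sqr => /orP[] /eqP->; rewrite ?mulNr divff ?vunitN ?rpred1 //.
(* This sum is the trace of delta x from the field generated by the [r i] to the rationals. *)
have Rrat x : X x -> \sum_(s | `[<G s>]) N s (delta * x) \in Crat.
  move=> [_ dx]; apply: aut_fixed_rat => tau; have [t tE] := aut_perm tau.
  have Gt : G t by exists tau.
  have GM s : `[<G (s * t)%g>] = `[<G s>].
    apply/asboolP/asboolP => -[nu nuE].
      exists (algC_invaut tau \o nu : autC) => i /=.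
      by rewrite nuE permM -tE algC_autK.
    by exists (tau \o nu : autC) => i; rewrite /= nuE tE permM.
  rewrite rmorph_sum [RHS](reindex_inj (mulIg t)) /=.
  apply: eq_big => [s|s /asboolP Gs]; first by rewrite GM.
  have Gst : G (s * t)%g by apply/asboolP; rewrite GM; apply/asboolP.
  have E i : (tau \o N s : autC) (r i) = N (s * t)%g (r i).
    by rewrite /= NE // tE NE // permM.
  by rewrite !rmorphM -(dx _ _ E) -(Rd _ _ E) /=.
(* The trace R = delta S satisfies R^2 = l u S^2, so it has positive valuation; being rational, it
   is divisible by l. Then S^2 = l (R/l)^2 / u lies in the maximal ideal. *)
have Smax x : X x -> \sum_(s <- sq) N s delta / delta * N s x \in vmax v.
  move=> Xx; rewrite big_filter; set S := \sum_(_ | _) _.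
  have vS : S \in v.
    by apply: rpred_sum => s _; rewrite rpredM ?(vunit_vr (sgn _)) //; case: Xx.
  set R := \sum_(s | `[<G s>]) N s (delta * x) in Rrat.
  have RQ := Rrat x Xx; have RS : R = delta * S.
    by rewrite mulr_sumr; apply: eq_bigr => s _; rewrite rmorphM; field.
  have R2 : R ^+ 2 = l%:R * (u * S ^+ 2) by rewrite RS exprMn dE mulrA.
  have vR : R \in v.
    apply: (@vr_root _ v R 2) => //; rewrite R2 !rpredM ?rpredX ?rpred_nat //.
    exact: vunit_vr.
  have mR : R \in vmax v.
    apply: (@vmaxX _ v R 2) => //; rewrite R2; apply: vmaxMr; rewrite ?vmax_prime //.
    by rewrite rpredM ?rpredX // (vunit_vr uu).
  have vRl := vmax_rat l_pr RQ mR.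
  apply: (@vmaxX _ v S 2) => //.
  have -> : S ^+ 2 = l%:R * ((R / l%:R) ^+ 2 / u).
    have u0 := vunit_neq0 uu; rewrite expr_div_n R2; field; exact/andP.
  apply: vmaxMr; rewrite ?vmax_prime // rpredM ?rpredX //.
  by rewrite vunit_vr // rpredV.
have G1 : G 1%g by exists idfun => i; rewrite perm1.
have sq1 : 1%g \in sq by rewrite mem_filter mem_index_enum andbT; apply/asboolP.
apply: (@vunit_vmax _ v (N 1%g delta / delta)) => //.
apply: (@independence_mod _ v X _ (fun s => N s) sq (fun s => N s delta / delta)) => //.
- by move=> s x [].
- by move=> s; rewrite rmorph1.
- by move=> s x y; rewrite rmorphM.
- by rewrite filter_uniq // index_enum_uniq.
(* Two representatives congruent on all of [X] would differ by an inertia automorphism, which acts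
   trivially by assumption. *)
- move=> s t; rewrite !mem_filter => /andP[/asboolP Gs _] /andP[/asboolP Gt _] nst.
  apply: contrapT => nx; case/eqP: nst; apply/permP => i; apply: r_inj.
  have inu : forall j, (N s \o algC_invaut (N t) : autC) (r j) - r j \in vmax v.
    move=> j /=; have [k kE] := r_aut (algC_invaut (N t) : autC) j.
    rewrite kE; apply: contrapT => /negP nk; apply: nx; exists (r k) => //.
    by rewrite -[in N t _]kE algC_invautK.
  by have /= := trivI _ inu (t i); rewrite -(NE t Gt) algC_autK !NE.
- by move=> s; rewrite vunit_vr.
Qed.

End FiniteConjugates.

(** Induction on the support: composing with the transposition of s x and x, which lie in one fibre,
    makes x fixed and moves no new point. *)
Lemma fibre_perm_ind (T : finType) (Y : Type) (h : T -> Y) (G : {perm T} -> Prop) :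
  G 1%g -> (forall s t, G s -> G t -> G (s * t)%g) ->
  (forall i j, h i = h j -> G (tperm i j)) ->
  forall s : {perm T}, (forall i, h (s i) = h i) -> G s.
Proof.
move=> G1 GM Gt s; have [k] := ubnP #|[set x | s x != x]|.
elim: k s => // k IH s; rewrite ltnS => lek hs.
have [s1|[x]] := set_0Vmem [set x | s x != x].
  have -> // : s = 1%g; apply/permP => x; rewrite perm1; apply/eqP.
  by have /setP/(_ x) := s1; rewrite !inE => /negbFE.
rewrite inE => nsx; pose t := (s * tperm (s x) x)%g.
have -> : s = (t * tperm (s x) x)%g by rewrite -mulgA tperm2 mulg1.
have ht i : h (tperm (s x) x i) = h i by case: tpermP => // ->; rewrite hs.
apply: GM; last by apply: Gt; rewrite hs.
apply: IH => [|i]; last by rewrite permM ht hs.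
apply: leq_trans lek; apply: proper_card; apply/properP; split; last first.
  by exists x; rewrite !inE // permM tpermL eqxx.
apply/fintype.subsetP => y; rewrite !inE permM; apply: contra => /eqP sy.
rewrite sy; case: tpermP => // yE; case/eqP: nsx; last by rewrite -yE.
by apply: (@perm_inj _ s); rewrite -yE.
Qed.

(** * Compactness: limits of sequences of automorphisms *)

Section Limit.
Local Open Scope classical_set_scope.

(** The limit is taken along an ultrafilter refining the filter of tails. Each [sigma m x] lies
    among the finitely many roots of the minimal polynomial of x, so the ultrafilter selects one
    value. *)
Lemma aut_limit (sigma : nat -> autC) : exists nu : autC, forall x y,
  (exists N, forall m, (N <= m)%N -> sigma m x = y) -> nu x = y.
Proof.
have [U [UU leU]] := ultraFilterLemma eventually_filter.
have /choice[nu nuE] x : exists y, U [set m | sigma m x = y].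
  have [r Dr] := closed_field_poly_normal (minCpoly x).
  have inr m : sigma m x \in r.
    have : root (minCpoly x) (sigma m x) by rewrite -(minCpoly_aut (sigma m)) root_minCpoly.
    by rewrite Dr (monicP (minCpoly_monic x)) scale1r root_prod_XsubC.
  have : U [set m | sigma m x \in r] by apply: filterS filterT => m _; apply: inr.
  elim: r {Dr inr} => [|a r IH] Ur.
    by have [m] := filter_ex Ur.
  have [Ua|Una] := in_ultra_setVsetC [set m | sigma m x = a] UU; first by exists a.
  apply: IH; apply: filterS (filterI Ur Una) => m /= [].
  by rewrite inE => /orP[/eqP|].
have nuP x y : U [set m | sigma m x = y] -> nu x = y.
  by move=> Ux; have [m /= [<- <-]] := filter_ex (filterI (nuE x) Ux).
have nua : zmod_morphism nu.
  move=> x y; apply: nuP; apply: filterS (filterI (nuE x) (nuE y)) => m /= [<- <-].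
  exact: rmorphB.
have num : monoid_morphism nu.
  split=> [|x y]; apply: nuP; first by apply: filterS filterT => m _ /=; rewrite rmorph1.
  apply: filterS (filterI (nuE x) (nuE y)) => m /= [<- <-]; exact: rmorphM.
pose nuaM := GRing.isZmodMorphism.Build _ _ nu nua.
pose numM := GRing.isMonoidMorphism.Build _ _ nu num.
exists (HB.pack nu nuaM numM : autC) => x y [N sE] /=; apply: nuP; apply: leU.
by exists N.
Qed.

End Limit.

(** * Transitivity on each level *)

Lemma perm_map_aut (nu : autC) (s : seq algC) :
  uniq s -> (forall x, x \in s -> nu x \in s) -> perm_eq (map nu s) s.
Proof.
move=> us ns; have um : uniq (map nu s) by rewrite map_inj_uniq //; apply: fmorph_inj.
apply: uniq_perm => //.
have sub : {subset map nu s <= s} by move=> _ /mapP[x xs ->]; apply: ns.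
by have [] := uniq_min_size um sub; rewrite ?size_map.
Qed.

Lemma edegD n m : (edeg n m + n ^ m = edeg n m.+1)%N.
Proof. by elim: m => [|m IH]; rewrite ?expnS /= ?muln0 //; move: IH => /=; nia. Qed.

Lemma coprime_edeg n m : coprime (edeg n m.+1) (n ^ m.+1).
Proof. by rewrite coprime_sym coprimeXl //= -addn1 /coprime mulnC gcdnMDl gcdn1. Qed.

Section Dynamics.
Variables (n : nat) (A : algC).
Hypotheses (n_gt1 : (1 < n)%N) (A_rat : A \in Crat) (A_neq0 : A != 0).

Definition fC (x : algC) := A * x * (x - 1) ^+ n.-1 + 1.
Definition fP : {poly algC} := A *: ('X * ('X - 1) ^+ n.-1) + 1.
Definition FP m := iter m (fun g => fP \Po g) 'X.

Lemma fPE x : fP.[x] = fC x.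
Proof. by rewrite /fP /fC !hornerE. Qed.

Lemma FPE m x : (FP m).[x] = iter m fC x.
Proof.
by elim: m => [|m IH]; rewrite /FP /= ?hornerX // horner_comp -/(FP m) IH fPE.
Qed.

Lemma fC_aut (nu : autC) x : nu (fC x) = fC (nu x).
Proof. by rewrite /fC rmorphD !rmorphM rmorph1 /= rmorphXn rmorphB rmorph1 (aut_Crat nu A_rat). Qed.

Lemma iter_fC_aut (nu : autC) m x : nu (iter m fC x) = iter m fC (nu x).
Proof. by elim: m => //= m IH; rewrite fC_aut IH. Qed.

Lemma fC0 : fC 0 = 1. Proof. by rewrite /fC mulr0 mul0r add0r. Qed.

Lemma fC1 : fC 1 = 1.
Proof.
rewrite /fC subrr expr0n; case: n n_gt1 => [|[]] //= k _.
by rewrite mulr0 add0r.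
Qed.

Lemma iter_fC1 m : iter m fC 1 = 1.
Proof. by elim: m => //= m ->; apply: fC1. Qed.
Lemma iter_fC0 m : iter m.+1 fC 0 = 1.
Proof. by rewrite iterSr fC0 iter_fC1. Qed.

Lemma size_fP0 : size ('X * ('X - 1) ^+ n.-1 : {poly algC}) = n.+1.
Proof.
have X1 : 'X - 1 = 'X - 1%:P :> {poly algC} by rewrite polyC1.
rewrite mulrC size_mulX ?X1 ?size_exp_XsubC ?prednK //; first by rewrite ltnW.
by rewrite expf_neq0 // polyXsubC_eq0.
Qed.

Lemma size_fP : size fP = n.+1.
Proof.
rewrite /fP size_polyDl size_scale ?size_fP0 // size_poly1 ltnS; lia.
Qed.

Lemma lead_fP : lead_coef fP = A.
Proof.
rewrite /fP lead_coefDl ?size_scale ?size_fP0 ?size_poly1 ?ltnS //; last by lia.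
rewrite lead_coefZ lead_coefM lead_coefX mul1r -polyC1.
by rewrite (monicP (monic_exp _ (monicXsubC _))) mulr1.
Qed.

Lemma size_FP m : size (FP m) = (n ^ m).+1.
Proof.
elim: m => [|m IH]; first by rewrite size_polyX.
have := size_comp_poly fP (FP m); rewrite size_fP IH /= -expnS => <-.
rewrite prednK // lt0n size_poly_eq0 comp_poly_eq0 ?IH ?ltnS ?expn_gt0 ?(ltnW n_gt1) //.
by rewrite -size_poly_eq0 size_fP.
Qed.

Lemma lead_FP m : lead_coef (FP m) = A ^+ edeg n m.
Proof.
elim: m => [|m IH]; first by rewrite lead_coefX.
rewrite /FP iterS lead_coef_comp -/(FP m); last by rewrite size_FP ltnS expn_gt0 (ltnW n_gt1).
by rewrite lead_fP IH size_fP /= -exprM mulnC -exprS.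
Qed.

Lemma FP_factor m : exists2 r : seq algC, size r = (n ^ m)%N &
  FP m = A ^+ edeg n m *: \prod_(z <- r) ('X - z%:P).
Proof.
have [r Dr] := closed_field_poly_normal (FP m); exists r; last by rewrite {1}Dr lead_FP.
have := size_FP m; rewrite Dr lead_FP size_scale ?expf_neq0 // size_prod_XsubC.
by case.
Qed.

(** * Valuations of the roots at [p] *)

Section AtNumeratorPrime.
Variables (p : nat) (v : valring p).
Hypotheses (p_pr : prime p) (Ap : A / p%:R \in vunit v).

Lemma A_vmax : A \in vmax v.
Proof.
have p0 : p%:R != 0 :> algC by rewrite pnatr_eq0 -lt0n prime_gt0.
by rewrite -(divfK p0 A) vmaxMl ?vmax_prime // vunit_vr.
Qed.

(** For integral x, f x - 1 is a multiple of A, hence in the maximal ideal. For a pole x, the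
    quotient (x - 1) / x is a unit, so f x - 1 is p x^n times a unit. *)
Lemma fC_pole x : fC x - 1 \notin vmax v ->
  x \notin v /\ p%:R * x ^+ n / (fC x - 1) \in vunit v.
Proof.
move=> na; have p0 : p%:R != 0 :> algC by rewrite pnatr_eq0 -lt0n prime_gt0.
have E : fC x - 1 = A * x * (x - 1) ^+ n.-1 by rewrite /fC addrK.
have nvx : x \notin v.
  apply: contra na => vx; rewrite E -mulrA vmaxMr ?A_vmax //.
  by rewrite rpredM ?rpredX ?rpredB ?rpred1.
have x0 : x != 0 by apply: contraNneq nvx => ->; rewrite rpred0.
have ux : 1 - x^-1 \in vunit v.
  by rewrite vunitDm ?rpred1 ?rpredN ?vr_inv_vmax.
have x1 : x - 1 = x * (1 - x^-1) by rewrite mulrBr mulr1 divff.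
split=> //; rewrite E x1 exprMn.
have -> : p%:R * x ^+ n / (A * x * (x ^+ n.-1 * (1 - x^-1) ^+ n.-1)) =
   (A / p%:R * (1 - x^-1) ^+ n.-1)^-1.
  rewrite -[in X in X = _](prednK (ltnW n_gt1)) exprS.
  have := vunit_neq0 ux; set y := 1 - x^-1 => y0.
  field; rewrite ?A_neq0 ?p0 ?x0 ?expf_neq0 //.
by rewrite rpredV rpredM ?rpredX.
Qed.

(** In multiplicative form: v(x) = -([edeg n m.+1] / n^(m+1)) v(p). *)
Lemma level_pole m x : iter m.+1 fC x = 0 ->
  x \notin v /\ x ^+ (n ^ m.+1) * p%:R ^+ edeg n m.+1 \in vunit v.
Proof.
elim: m x => [|m IH] x.
  move=> /= x0; have [|nx] := @fC_pole x; first by rewrite x0 sub0r rpredN one_notin_vmax.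
  rewrite x0 sub0r invrN invr1 mulrN1 vunitN => ux.
  by rewrite expn1 muln0 expr1 mulrC.
rewrite iterSr => /IH[nva ua].
have a0 : fC x != 0 by apply: contraNneq nva => ->; rewrite rpred0.
have a1 : fC x - 1 = fC x * (1 - (fC x)^-1) by rewrite mulrBr mulr1 divff.
have ua1 : 1 - (fC x)^-1 \in vunit v.
  by rewrite vunitDm ?rpred1 ?rpredN ?vr_inv_vmax.
have [|nx ux] := @fC_pole x.
  apply: contra nva => ma; rewrite -(subrK 1 (fC x)) rpredD ?rpred1 //.
  exact: vmax_vr.
split=> //.
have ux' : p%:R * x ^+ n / fC x \in vunit v.
  have -> : p%:R * x ^+ n / fC x = p%:R * x ^+ n / (fC x - 1) * (1 - (fC x)^-1).
    rewrite a1; have := vunit_neq0 ua1; set y := 1 - _ => y0.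
    by field; rewrite a0 y0.
  by rewrite rpredM.
have -> : x ^+ (n ^ m.+2) * p%:R ^+ edeg n m.+2 =
  (p%:R * x ^+ n / fC x) ^+ (n ^ m.+1) * (fC x ^+ (n ^ m.+1) * p%:R ^+ edeg n m.+1).
  rewrite -edegD exprD expnS exprM expr_div_n exprMn.
  by field; rewrite expf_neq0.
by rewrite rpredM ?rpredX.
Qed.

Lemma prime_expz_unit (k : int) : (p%:R : algC) ^ k \in vunit v -> k = 0.
Proof.
have pk j : (p%:R : algC) ^+ j.+1 \in vmax v.
  by rewrite exprS vmaxMr ?vmax_prime ?rpredX ?rpred_nat.
case: k => [[|k]|k] //; first by rewrite -exprnP => /vunit_vmax; case/(_ (pk k)).
by rewrite NegzE -exprnN rpredV => /vunit_vmax; case/(_ (pk k)).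
Qed.

(** The product of an orbit is rational, so its valuation is an integer k, and [level_pole] gives k
    n^(m+1) = -[edeg n m.+1] times the orbit size. As [edeg n m.+1] is prime to n, n^(m+1) divides
    that size. *)
Lemma level_transitive m : exists r : seq algC,
  [/\ uniq r, size r = (n ^ m.+1)%N, forall x, (x \in r) = (iter m.+1 fC x == 0),
      FP m.+1 = A ^+ edeg n m.+1 *: \prod_(z <- r) ('X - z%:P) &
      forall x y, x \in r -> y \in r -> exists nu : autC, nu x = y].
Proof.
have [r szr rE] := FP_factor m.+1; exists r.
have p0 : p%:R != 0 :> algC by rewrite pnatr_eq0 -lt0n prime_gt0.
have memr x : (x \in r) = (iter m.+1 fC x == 0).
  by rewrite -root_prod_XsubC -FPE rE -rootE rootZ // expf_neq0.
have M0 : (0 < n ^ m.+1)%N by rewrite expn_gt0 (ltnW n_gt1).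
have raut (nu : autC) x : x \in r -> nu x \in r.
  by rewrite !memr -iter_fC_aut fmorph_eq0.
have big x : x \in r -> (n ^ m.+1 <= count (fun y => `[<exists nu : autC, nu x = y>]) (undup r))%N.
  move=> xr; set P := fun y => _; set s := [seq y <- undup r | P y].
  have us : uniq s by rewrite filter_uniq ?undup_uniq.
  have mems y : (y \in s) = P y && (y \in r) by rewrite mem_filter mem_undup.
  have Px : P x by apply/asboolP; exists idfun.
  rewrite -size_filter -/s; have s0 : (0 < size s)%N.
    by case: s {us} mems => // /(_ x); rewrite Px xr.
  have saut (nu : autC) y : y \in s -> nu y \in s.
    rewrite !mems => /andP[/asboolP[mu muE] yr]; rewrite raut // andbT.
    by apply/asboolP; exists (nu \o mu : autC); rewrite /= muE.
  pose rho := \prod_(y <- s) y.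
  have rhoQ : rho \in Crat.
    apply: aut_fixed_rat => nu; rewrite rmorph_prod /=.
    rewrite -(big_map nu predT id) /=; apply: perm_big.
    by apply: perm_map_aut => // y; apply: saut.
  have lev y : y \in s -> y \notin v /\ y ^+ (n ^ m.+1) * p%:R ^+ edeg n m.+1 \in vunit v.
    by rewrite mems memr => /andP[_ /eqP /level_pole].
  have rho0 : rho != 0.
    rewrite prodf_seq_neq0; apply/allP => y /lev[nvy _] /=.
    by apply: contraNneq nvy => ->; rewrite rpred0.
  have urho : rho ^+ (n ^ m.+1) * p%:R ^+ (edeg n m.+1 * size s) \in vunit v.
    have -> : rho ^+ (n ^ m.+1) * p%:R ^+ (edeg n m.+1 * size s) =
      \prod_(y <- s) (y ^+ (n ^ m.+1) * p%:R ^+ edeg n m.+1).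
      rewrite big_split /= prodrXl; congr (_ * _).
      by rewrite exprM big_const_seq count_predT iter_mulr_1.
    by rewrite big_seq rpred_prod // => y /lev[].
  have [k uk] := rat_prime_unit v p_pr rhoQ rho0.
  have : k * (n ^ m.+1)%:Z + (edeg n m.+1 * size s)%:Z = 0.
    apply: prime_expz_unit; rewrite expfzDr // -exprz_exp -!exprnP.
    have -> : (p%:R ^ k) ^+ (n ^ m.+1) * p%:R ^+ (edeg n m.+1 * size s) =
       rho ^+ (n ^ m.+1) * p%:R ^+ (edeg n m.+1 * size s) / (rho / p%:R ^ k) ^+ (n ^ m.+1) :> algC.
      by rewrite expr_div_n; field; rewrite !expf_neq0 ?expfz_neq0.
    by rewrite rpred_div ?rpredX.
  move/(congr1 (fun t => (n ^ m.+1)%:Z %| t)%Z); rewrite dvdz0 rpredDl ?dvdz_mull //.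
  have co : coprime (n ^ m.+1) (edeg n m.+1) by rewrite coprime_sym coprime_edeg.
  rewrite dvdzE !absz_nat (Gauss_dvdr _ co) => dv; exact: (dvdn_leq s0 dv).
have [x xr] : exists x, x \in r.
  case: r szr {rE memr raut big} => [|x r]; last by exists x; rewrite mem_head.
  by move=> /= E; rewrite -E in M0.
(* One orbit already supplies as many distinct roots as the degree, so no root is repeated. *)
have ur : uniq r.
  rewrite -[uniq r]negbK -ltn_size_undup -leqNgt szr.
  exact: leq_trans (big x xr) (count_size _ _).
split=> // y z yr zr; have := big y yr; rewrite undup_id // -szr leq_eqVlt.
rewrite ltnNge count_size orbF eq_sym -all_count => /allP/(_ z zr)/asboolP.
by [].
Qed.

End AtNumeratorPrime.
End Dynamics.

(** * Transitivity on pairs of siblings *)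

Lemma vr_mulXsub1 p (v : valring p) x k : x * (x - 1) ^+ k \in v -> x \in v.
Proof.
move=> vxk; apply: contraT => nvx.
have x0 : x != 0 by apply: contraNneq nvx => ->; rewrite rpred0.
have ux : 1 - x^-1 \in vunit v by rewrite vunitDm ?rpred1 ?rpredN ?vr_inv_vmax.
suff : x ^+ k.+1 \in v by move/(vr_root (ltn0Sn k)); rewrite (negPf nvx).
have -> : x ^+ k.+1 = x * (x - 1) ^+ k / (1 - x^-1) ^+ k.
  have -> : x - 1 = x * (1 - x^-1) by rewrite mulrBr mulr1 divff.
  by rewrite exprMn exprS mulrA mulfK // expf_neq0 // (vunit_neq0 ux).
by rewrite rpredM // vunit_vr // rpredV rpredX.
Qed.

(** The polynomial x (x-1)^k has a simple root at residue 0: the difference of two values is x - y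
    times a unit. *)
Lemma vmax_mulXsub1_inj p (v : valring p) x y k : x \in vmax v -> y \in vmax v ->
  x * (x - 1) ^+ k = y * (y - 1) ^+ k -> x = y.
Proof.
move=> mx my E; have [vx vy] := (vmax_vr mx, vmax_vr my).
pose S := \sum_(i < k) (x - 1) ^+ (k.-1 - i) * (y - 1) ^+ i.
have vS : S \in v.
  by apply: rpred_sum => i _; rewrite rpredM ?rpredX ?rpredB ?rpred1.
have : (x - y) * ((x - 1) ^+ k + y * S) = 0.
  have : (x - 1) ^+ k - (y - 1) ^+ k = (x - y) * S.
    by rewrite subrXX opprB addrA subrK.
  move=> D; have -> : (x - y) * ((x - 1) ^+ k + y * S) =
      x * (x - 1) ^+ k - y * (x - 1) ^+ k + y * ((x - y) * S).
    by ring.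
  by rewrite -D E; ring.
move/eqP; rewrite mulf_eq0 subr_eq0 => /orP[/eqP//|/eqP Z].
have : (x - 1) ^+ k + y * S \in vunit v.
  rewrite vunitDm //; last by rewrite vmaxMr.
  by rewrite rpredX // -opprB vunitN vunitDm ?rpred1 ?rpredN.
by move/vunit_neq0; rewrite Z eqxx.
Qed.

Section AtDenominatorPrime.
Variables (n : nat) (A : algC).
Hypotheses (n_gt1 : (1 < n)%N) (A_rat : A \in Crat) (A_neq0 : A != 0).
Variables (q : nat) (v : valring q).
Hypotheses (q_pr : prime q) (Aq : A * q%:R \in vunit v).
Local Notation f := (fC n A).
Local Notation w := (A * q%:R).

Let q0 : q%:R != 0 :> algC.
Proof. by rewrite pnatr_eq0 -lt0n prime_gt0. Qed.

Lemma fC_eq x : x * (x - 1) ^+ n.-1 = q%:R * ((f x - 1) / w).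
Proof. by rewrite /fC addrK; field; rewrite A_neq0 q0. Qed.

Lemma size_fP_subC a : size (fP n A - a%:P) = n.+1.
Proof.
rewrite size_polyDl ?size_fP // size_polyN (leq_ltn_trans (size_polyC_leq1 _)) //.
by rewrite ltnS ltnW.
Qed.

Lemma vr_divw x : x \in v -> x / w \in v.
Proof. by move=> vx; rewrite rpredM // vunit_vr // rpredV. Qed.

Lemma fC_integral x : f x \in v -> x \in v.
Proof.
move=> vf; apply: (@vr_mulXsub1 _ v x n.-1); rewrite fC_eq rpredM ?rpred_nat //.
by rewrite vr_divw // rpredB ?rpred1.
Qed.

Lemma level_integral m x : iter m f x = 0 -> x \in v.
Proof.
elim: m x => [|m IH] x; first by move=> /= ->; rewrite rpred0.
by rewrite iterSr => /IH/fC_integral.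
Qed.

(** Modulo q, x (x-1)^(n-1) vanishes once at 0 and n - 1 times at 1. Away from residue 0, the
    valuation of (x-1)^(n-1) is that of q (f x - 1). *)
Lemma fC_unit_residue x : f x \in v -> x \notin vmax v ->
  x \in vunit v /\ (x - 1) ^+ n.-1 / q%:R = (f x - 1) / w / x.
Proof.
move=> vf nx; have vx := fC_integral vf; have ux : x \in vunit v by rewrite vunitE vx.
split=> //; have := fC_eq x; have := vunit_neq0 ux => x0 E.
have -> : (x - 1) ^+ n.-1 = q%:R * ((f x - 1) / w) / x by rewrite -E mulrC mulKf.
by field; rewrite x0 A_neq0 q0.
Qed.

Lemma zero_path_uniq m x y : iter m f x = 0 -> iter m f y = 0 ->
  (forall k, (k < m)%N -> iter k f x \in vmax v) ->
  (forall k, (k < m)%N -> iter k f y \in vmax v) -> x = y.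
Proof.
elim: m x y => [|m IH] x y; first by move=> /= -> ->.
rewrite !iterSr => fx fy px py; have E : f x = f y.
  by apply: IH => // k km; rewrite -iterSr; [apply: px | apply: py].
apply: (@vmax_mulXsub1_inj _ v _ _ n.-1); [exact: (px 0%N) | exact: (py 0%N) |].
by rewrite !fC_eq E.
Qed.

(** The product of the negated preimages of a is (1 - a) / A, a multiple of q, so some preimage lies
    in the maximal ideal. *)
Lemma zero_path_exists m : exists2 x, iter m f x = 0 &
  forall k, (k < m)%N -> iter k f x \in vmax v.
Proof.
elim: m => [|m [a a0 pa]]; first by exists 0.
have va := level_integral a0.
have [s sE] := closed_field_poly_normal (fP n A - a%:P).
have lE : lead_coef (fP n A - a%:P) = A.
  by rewrite lead_coefDl ?lead_fP // size_polyN size_fP // size_polyC; case: eqP => //=; lia.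
have rootE' x : (fP n A - a%:P).[x] = f x - a by rewrite hornerD hornerN hornerC fPE.
have vs x : x \in s -> f x = a.
  move=> xs; apply/eqP; rewrite -subr_eq0 -rootE' sE lE hornerZ mulf_eq0 (negPf A_neq0) /=.
  by rewrite -rootE root_prod_XsubC.
have : \prod_(z <- s) (- z) \in vmax v.
  have : A * \prod_(z <- s) (- z) = 1 - a.
    have := rootE' 0; rewrite fC0 sE lE hornerZ horner_prod => <-; congr (_ * _).
    by apply: eq_bigr => z _; rewrite !hornerE.
  move=> E; have -> : \prod_(z <- s) (- z) = q%:R * ((1 - a) / w).
    by rewrite -E; field; rewrite A_neq0 q0.
  by rewrite vmaxMr ?vmax_prime // vr_divw // rpredB ?rpred1.
case/vmax_prod => [i si _|x /andP[xs _]].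
  by rewrite rpredN; apply: fC_integral; rewrite vs.
rewrite rpredN => mx; exists x; first by rewrite iterSr vs.
by case=> [|k] //; rewrite ltnS iterSr vs //; apply: pa.
Qed.

(* The weights e b kill, modulo q, every root but b0, so that the rational number
   T has the same valuation as y b0, namely s / (n - 1) with s the number of
   siblings related to b0; integrality forces s >= n - 1. *)
Lemma sibling_transitive m (r : seq algC) (O : algC -> algC -> Prop) :
  uniq r -> (forall x, (x \in r) = (iter m.+1 f x == 0)) ->
  (forall x y, x \in r -> y \in r -> exists nu : autC, nu x = y) ->
  (forall x y, O x y -> [/\ x \in r, y \in r, x != y & f x = f y]) ->
  (forall (nu : autC) x y, O x y -> O (nu x) (nu y)) ->
  (exists x y, O x y) ->
  forall x y, x \in r -> y \in r -> x != y -> f x = f y -> O x y.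
Proof.
move=> ur memr trans OE Oaut [x0 [y0 O0]].
have raut (nu : autC) x : x \in r -> nu x \in r.
  by rewrite !memr -iter_fC_aut // fmorph_eq0.
have Oaut' (nu : autC) x y : `[<O (nu x) (nu y)>] = `[<O x y>].
  apply/asboolP/asboolP; last exact: Oaut.
  by move/(Oaut (algC_invaut nu)); rewrite /= !algC_autK.
have [b0 b0r pb0] := zero_path_exists m.+1.
have rb0 : b0 \in r by rewrite memr b0r.
have [x0r y0r _ _] := OE _ _ O0.
have [nu0 nu0E] := trans _ _ x0r rb0.
have O1 : O b0 (nu0 y0) by rewrite -nu0E; apply: Oaut.
pose y b := \prod_(c <- r | `[<O b c>]) (c - 1).
pose e b := \prod_(k < m.+1) (1 - iter k f b).
pose T := \sum_(b <- r) e b ^+ n.-1 * y b.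
have TQ : T \in Crat.
  apply: aut_fixed_rat => nu; have pm := perm_map_aut ur (raut nu).
  rewrite rmorph_sum /T -[RHS](perm_big _ pm) /= big_map; apply: eq_bigr => b _.
  rewrite rmorphM rmorphXn /=; congr (_ ^+ _ * _).
    rewrite /e rmorph_prod; apply: eq_bigr => k _; rewrite rmorphB rmorph1 /= iter_fC_aut //.
  rewrite /y rmorph_prod -[RHS](perm_big _ pm) /= big_map; apply: eq_big => c.
    by rewrite Oaut'.
  by rewrite rmorphB rmorph1.
have rv b k : b \in r -> (k <= m.+1)%N -> iter k f b \in v.
  rewrite memr => /eqP b0'; move=> km; apply: (@level_integral (m.+1 - k)%N).
  by rewrite -iterD subnK.
have f1 k x : f (iter k f x) = iter k.+1 f x by [].
have ev b : b \in r -> e b \in v.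
  move=> br; apply: rpred_prod => k _; rewrite rpredB ?rpred1 ?rv // ltnW //.
have yv b : b \in r -> y b \in v.
  move=> br; rewrite /y big_seq_cond; apply: rpred_prod => c /andP[cr _].
  by rewrite rpredB ?rpred1 ?(rv c 0%N).
(* By [zero_path_uniq] the orbit of b leaves the maximal ideal at some k, and there (1 - f^k
   b)^(n-1) is divisible by q. *)
have eq b : b \in r -> b != b0 -> e b ^+ n.-1 / q%:R \in v.
  move=> br nb; have [k km nk] : exists2 k, (k < m.+1)%N & iter k f b \notin vmax v.
    apply: contrapT => np; case/eqP: nb; apply: (@zero_path_uniq m.+1) => //.
      by move: br; rewrite memr => /eqP.
    move=> k km; apply: contrapT => nk; apply: np; exists k => //; exact/negP.
  have [] := @fC_unit_residue (iter k f b) _ nk; first by rewrite f1 rv.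
  rewrite f1 => uk kE; rewrite /e (bigD1 (Ordinal km)) //= exprMn mulrAC.
  have k1 : (iter k.+1 f b - 1) / w \in v by rewrite vr_divw // rpredB ?rpred1 ?rv.
  have k2 : (iter k f b)^-1 \in v by rewrite vunit_vr // rpredV.
  apply: rpredM.
    rewrite -opprB exprNn -mulrA kE; apply: rpredM; last exact: rpredM.
    by rewrite rpredX ?rpredN1.
  rewrite rpredX //; apply: rpred_prod => i _; by rewrite rpredB ?rpred1 ?rv // ltnW.
have ue0 : e b0 \in vunit v.
  by apply: rpred_prod => k _; rewrite vunitDm ?rpred1 ?rpredN ?pb0.
have ua : f b0 - 1 \in vunit v.
  rewrite -opprB vunitN vunitDm ?rpred1 ?rpredN //.
  case: (m) b0r pb0 => [/= -> _|m' _ pb]; first exact: rpred0.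
  exact: (pb 1%N).
(* A sibling of b0 cannot share its residue 0, so it is near 1; as f b0 - 1 is a unit, v(c - 1) is
   exactly v(q) / (n - 1). *)
have sib c : O b0 c -> [/\ c \in vunit v, c - 1 \in vmax v & (c - 1) ^+ n.-1 / q%:R \in vunit v].
  move=> /OE[_ cr nbc fE]; have vf : f c \in v by rewrite (rv c 1%N).
  have nc : c \notin vmax v.
    apply: contra nbc => mc; apply/eqP; apply: (@vmax_mulXsub1_inj _ v _ _ n.-1) => //.
      exact: (pb0 0%N).
    by rewrite !fC_eq fE.
  have [uc cE] := fC_unit_residue vf nc; split=> //; last first.
    by rewrite cE -fE !rpredM // rpredV.
  apply: (@vmaxX _ v _ n.-1); first by rewrite rpredB ?rpred1 ?(vunit_vr uc).
  rewrite -(divfK q0 (_ ^+ _)) vmaxMl ?vmax_prime // cE !rpredM ?rpredV //.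
  - by rewrite rpredB ?rpred1.
  - by rewrite vunit_vr // rpredV.
  - by rewrite vunit_vr // rpredV.
pose s := count (fun c => `[<O b0 c>]) r.
have y1r : nu0 y0 \in r by apply: raut.
have my0 : y b0 \in vmax v.
  rewrite /y (big_rem _ y1r) /=; have -> : `[<O b0 (nu0 y0)>] by apply/asboolP.
  have [_ m1 _] := sib _ O1; apply: vmaxMr => //.
  rewrite big_seq_cond; apply: rpred_prod => c /andP[/mem_rem cr _].
  by rewrite rpredB ?rpred1 ?(rv c 0%N).
have TE : T = e b0 ^+ n.-1 * y b0 + q%:R * \sum_(b <- r | b != b0) (e b ^+ n.-1 / q%:R * y b).
  rewrite /T (bigD1_seq b0) //=; congr (_ + _); rewrite mulr_sumr.
  by apply: eq_bigr => b _; field.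
have vS : \sum_(b <- r | b != b0) (e b ^+ n.-1 / q%:R * y b) \in v.
  by rewrite big_seq_cond; apply: rpred_sum => b /andP[br nb]; rewrite rpredM ?eq ?yv.
have mT : T \in vmax v.
  rewrite TE rpredD //; first by rewrite vmaxMl // rpredX ?ev.
  by rewrite vmaxMr ?vmax_prime.
have vy0 : y b0 / q%:R \in v.
  have := vmax_rat q_pr TQ mT; move: vS; set S := \sum_(_ <- _ | _) _ in TE * => vS vT.
  have -> : y b0 / q%:R = (T / q%:R - S) / e b0 ^+ n.-1.
    by rewrite TE; field; rewrite q0 expf_neq0 // (vunit_neq0 ue0).
  by rewrite rpredM ?rpredB // vunit_vr // rpredV rpredX.
have uy0 : y b0 ^+ n.-1 / q%:R ^+ s \in vunit v.
  have -> : y b0 ^+ n.-1 / q%:R ^+ s = \prod_(c <- r | `[<O b0 c>]) ((c - 1) ^+ n.-1 / q%:R).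
    by rewrite big_split /= prodrXl big_const_seq iter_mulr_1 exprVn.
  by apply: rpred_prod => c /asboolP/sib[].
have les : (n.-1 <= s)%N.
  rewrite leqNgt; apply/negP => ls.
  suff : q%:R^-1 \in v by rewrite (negPf (vr_prime v)).
  apply: (@vr_root _ v _ (n.-1 - s)); first by rewrite subn_gt0.
  have -> : (q%:R : algC)^-1 ^+ (n.-1 - s) = (y b0 / q%:R) ^+ n.-1 / (y b0 ^+ n.-1 / q%:R ^+ s).
    have y00 : y b0 ^+ n.-1 != 0.
      have := vunit_neq0 uy0; rewrite mulf_eq0 negb_or => /andP[] //.
    have E : (q%:R : algC) ^+ n.-1 = q%:R ^+ (n.-1 - s) * q%:R ^+ s.
      by rewrite -exprD subnK // ltnW.
    rewrite exprVn expr_div_n E.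
    have B0 : (q%:R : algC) ^+ (n.-1 - s) != 0 by rewrite expf_neq0.
    have C0 : (q%:R : algC) ^+ s != 0 by rewrite expf_neq0.
    move: (_ ^+ (_ - _)) B0 (_ ^+ s) C0 (_ ^+ _) y00 => B B0 C C0 Y Y0.
    by field; rewrite B0 C0 Y0.
  by rewrite rpredM ?rpredX // vunit_vr // rpredV.
(* An unrelated sibling z, together with b0 and at least n - 1 related roots, would give n + 1 roots
   of a polynomial of degree n. *)
have all0 z : z \in r -> b0 != z -> f b0 = f z -> O b0 z.
  move=> zr nz fz; apply: contrapT => nO.
  have us : uniq [:: b0, z & [seq c <- r | `[<O b0 c>]]].
    rewrite /= inE (negPf nz) !mem_filter filter_uniq // andbT /=.
    apply/andP; split; last by apply/negP => /andP[/asboolP].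
    by apply/negP => /andP[/asboolP /OE[_ _ /eqP]].
  have := @max_poly_roots _ (fP n A - (f b0)%:P) _ _ _ us.
  have sz := size_fP_subC (f b0).
  rewrite sz /= size_filter -/s ltnS => H.
  suff sn : (s.+2 <= n)%N.
    have := leq_trans sn (leq_trans (leqSpred n) (_ : n.-1.+1 <= s.+1)%N).
    by rewrite !ltnS les ltnn => /(_ isT).
  apply: H; first by rewrite -size_poly_eq0 sz.
  have rt c : root (fP n A - (f b0)%:P) c = (f c == f b0).
    by rewrite rootE hornerD hornerN hornerC fPE subr_eq0.
  rewrite /= !rt eqxx -fz eqxx /=; apply/allP => c; rewrite mem_filter rt.
  by move=> /andP[/asboolP /OE[_ _ _ <-] _].
move=> x z xr zr nxz fxz; have [nu nuE] := trans _ _ xr rb0.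
apply/asboolP; rewrite -(Oaut' nu) nuE; apply/asboolP; apply: all0.
- exact: raut.
- by rewrite -nuE fmorph_eq.
- by rewrite -nuE -!fC_aut // fxz.
Qed.

End AtDenominatorPrime.

(** * Transpositions of siblings *)

(** For a duplicate-free [s], the discriminant, up to sign, of the monic polynomial with roots
    [s]. *)
Definition diffprod (s : seq algC) := \prod_(x <- s) \prod_(y <- s | y != x) (x - y).

(** The root d is the Vandermonde product over pairs of positions in the list; the sign depends on
    the length. *)
Lemma diffprod_sqrt (s : seq algC) : uniq s -> exists2 d : algC,
  d ^+ 2 = diffprod s \/ d ^+ 2 = - diffprod s &
  forall nu : autC, (forall x, x \in s -> nu x = x) -> nu d = d.
Proof.
elim: s => [|a s IH].
  by exists 1 => [|nu _]; rewrite ?rmorph1 // /diffprod big_nil expr1n; left.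
rewrite cons_uniq => /andP[nas /IH[d d2 dfix]].
pose P := \prod_(y <- s) (a - y).
have E : diffprod (a :: s) = (-1) ^+ size s * P ^+ 2 * diffprod s.
  rewrite /diffprod big_cons big_cons eqxx /=.
  have -> : \prod_(y <- s | y != a) (a - y) = P.
    rewrite /P big_seq_cond [RHS]big_seq_cond; apply: eq_bigl => y.
    by case ys: (y \in s) => //=; apply: contraNneq nas => <-.
  have -> : \prod_(x <- s) \prod_(y <- a :: s | y != x) (x - y) =
     \prod_(x <- s) ((-1) * (a - x) * \prod_(y <- s | y != x) (x - y)).
    rewrite big_seq [RHS]big_seq; apply: eq_bigr => x xs; rewrite big_cons.
    by rewrite (_ : a != x) ?mulN1r ?opprB //; apply: contraNneq nas => ->.
  rewrite !big_split /= big_const_seq count_predT iter_mulr_1 -/P; ring.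
exists (P * d).
  rewrite exprMn E -signr_odd; case: (odd _); case: d2 => ->; rewrite ?expr0 ?expr1.
  - by right; ring.
  - by left; ring.
  - by left; ring.
  - by right; ring.
move=> nu nus; rewrite rmorphM dfix; last by move=> x xs; apply: nus; rewrite inE xs orbT.
congr (_ * _); rewrite rmorph_prod big_seq [RHS]big_seq; apply: eq_bigr => y ys.
by rewrite rmorphB !nus ?inE ?eqxx ?ys ?orbT.
Qed.

Section AtCriticalPrime.
Variables (n : nat) (A : algC).
Hypotheses (n_gt1 : (1 < n)%N) (A_rat : A \in Crat) (A_neq0 : A != 0).
Variables (l : nat) (v : valring l).
Hypotheses (l_pr : prime l) (Au : A \in vunit v) (nu : n%:R \in vunit v).
Local Notation f := (fC n A).
Local Notation c := (n%:R^-1 : algC).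

Let vA : A \in v. Proof. exact: vunit_vr. Qed.
Let n0 : n%:R != 0 :> algC. Proof. exact: vunit_neq0 nu. Qed.
Let vc : c \in v. Proof. by rewrite vunit_vr // rpredV. Qed.

Lemma fC_vr x : x \in v -> f x \in v.
Proof. by move=> vx; rewrite /fC rpredD ?rpred1 // !rpredM ?rpredX ?rpredB ?rpred1. Qed.

Lemma iter_fC_vr k x : x \in v -> iter k f x \in v.
Proof. by move=> vx; elim: k => //= k /fC_vr. Qed.

Lemma fC_congr x y : x \in v -> y \in v -> x - y \in vmax v -> f x - f y \in vmax v.
Proof.
move=> vx vy mxy.
pose S := \sum_(i < n.-1) (x - 1) ^+ (n.-1.-1 - i) * (y - 1) ^+ i.
have -> : f x - f y = (x - y) * (A * (x - 1) ^+ n.-1 + A * y * S).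
  have D : (x - 1) ^+ n.-1 - (y - 1) ^+ n.-1 = (x - y) * S.
    by rewrite subrXX opprB addrA subrK.
  have -> : (x - y) * (A * (x - 1) ^+ n.-1 + A * y * S) =
     (x - y) * (A * (x - 1) ^+ n.-1) + A * y * ((x - y) * S) by ring.
  by rewrite -D /fC; ring.
rewrite vmaxMr // rpredD ?rpredM ?rpredX ?rpredB ?rpred1 //.
by apply: rpred_sum => i _; rewrite rpredM ?rpredX ?rpredB ?rpred1.
Qed.

Lemma iter_fC_congr k x y : x \in v -> y \in v -> x - y \in vmax v ->
  iter k f x - iter k f y \in vmax v.
Proof. by move=> vx vy mxy; elim: k => //= k; apply: fC_congr; rewrite iter_fC_vr. Qed.

Lemma level_integral_unit m x : iter m f x = 0 -> x \in v.
Proof.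
elim: m x => [|m IH] x; first by move=> /= ->; rewrite rpred0.
rewrite iterSr => /IH vf; apply: (@vr_mulXsub1 _ v x n.-1).
have -> : x * (x - 1) ^+ n.-1 = (f x - 1) / A by rewrite /fC addrK; field.
by rewrite rpredM ?rpredB ?rpred1 // vunit_vr // rpredV.
Qed.

Definition dfC (x : algC) := A * (x - 1) ^+ n.-2 * (n%:R * x - 1).

Lemma deriv_fP x : (fP n A)^`().[x] = dfC x.
Proof.
rewrite /fP -polyC1 derivD derivC addr0 derivZ derivM derivX deriv_exp.
rewrite derivXsubC !hornerE /dfC hornerMn !hornerE.
case: n n_gt1 => [|[|k]] //= _.
by rewrite -[k.+2%:R]natr1 -mulr_natr exprS; ring.
Qed.

Lemma deriv_FP m x : (FP n A m)^`().[x] = \prod_(k < m) dfC (iter k f x).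
Proof.
elim: m => [|m IH]; first by rewrite derivX hornerC big_ord0.
rewrite /FP iterS -/(FP n A m) deriv_comp hornerM horner_comp FPE deriv_fP IH.
by rewrite big_ord_recr mulrC.
Qed.

Variables (m : nat) (r : seq algC) (k0 : nat) (u0 : algC).
Hypotheses (ur : uniq r) (memr : forall x, (x \in r) = (iter m.+1 f x == 0)).
Hypothesis rE : FP n A m.+1 = A ^+ edeg n m.+1 *: \prod_(z <- r) ('X - z%:P).
Hypotheses (u0u : u0 \in vunit v) (cE : iter m.+1 f c = l%:R ^+ (2 * k0).+1 * u0).

Let raut (s : autC) x : x \in r -> s x \in r.
Proof. by rewrite !memr -iter_fC_aut // fmorph_eq0. Qed.

Let rv x : x \in r -> x \in v.
Proof. by rewrite memr => /eqP /level_integral_unit. Qed.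

Let mc : iter m.+1 f c \in vmax v.
Proof.
by rewrite cE exprS -mulrA vmaxMr ?vmax_prime // rpredM ?rpredX ?rpred_nat ?(vunit_vr u0u).
Qed.

(** Since 1 is fixed, an orbit meeting 1 modulo the maximal ideal would end at residue 1 instead of
    0. *)
Lemma orbit_sub1_unit x k : x \in r -> (k <= m)%N -> iter k f x - 1 \in vunit v.
Proof.
move=> xr km; have vk := iter_fC_vr k (rv xr).
rewrite vunitE rpredB ?rpred1 //=; apply/negP => mk.
have := iter_fC_congr (m.+1 - k) vk (rpred1 _) mk.
rewrite iter_fC1 // -iterD subnK ?(leqW km) //.
by move: xr; rewrite memr => /eqP ->; rewrite sub0r rpredN (negPf (one_notin_vmax _)).
Qed.

(** If f^k x had the residue of c, then f^(m+1-k) c would reduce to 0 and f^(m+1) c to f^k 0, which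
    is 1 because k > 0; but f^(m+1) c reduces to 0. *)
Lemma orbit_subc_unit x k : x \in r -> (0 < k <= m)%N -> n%:R * iter k f x - 1 \in vunit v.
Proof.
move=> xr /andP[k1 km]; have vk := iter_fC_vr k (rv xr).
rewrite vunitE rpredB ?rpredM ?rpred_nat ?rpred1 //=; apply/negP => mk.
have mk' : iter k f x - c \in vmax v.
  have -> : iter k f x - c = c * (n%:R * iter k f x - 1) by field.
  by rewrite vmaxMl.
have := iter_fC_congr (m.+1 - k) vk vc mk'.
rewrite -iterD subnK ?(leqW km) //; have /eqP -> : iter m.+1 f x == 0 by rewrite -memr.
rewrite sub0r rpredN => mk2.
have := @iter_fC_congr k (iter (m.+1 - k) f c) 0 (iter_fC_vr _ vc) (rpred0 _).
rewrite [X in X \in _ -> _]subr0 => /(_ mk2).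
rewrite -iterD subnKC ?(leqW km) //; case: (k) k1 => // k' _; rewrite iter_fC0 // => H.
by have := rpredB mc H; rewrite opprB addrC subrK (negPf (one_notin_vmax _)).
Qed.

(** In the chain rule only the factor n x - 1 at the start of the orbit can fail to be a unit. *)
Lemma deriv_level x : x \in r ->
  exists2 U, U \in vunit v & (FP n A m.+1)^`().[x] = U * (x - c).
Proof.
move=> xr; rewrite deriv_FP big_ord_recl /=.
exists (A * (x - 1) ^+ n.-2 * n%:R * \prod_(i < m) dfC (iter (lift ord0 i) f x)); last first.
  by rewrite /dfC /=; field.
rewrite rpredM //.
  by rewrite !rpredM ?rpredX ?(@orbit_sub1_unit x 0).
apply: rpred_prod => i _; rewrite /dfC.
have i1 : (0 < lift ord0 i <= m)%N by rewrite lift0 ltn_ord.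
have i2 : (lift ord0 i <= m)%N by case/andP: i1.
by rewrite !rpredM ?rpredX ?(orbit_sub1_unit xr i2) ?(orbit_subc_unit xr i1).
Qed.

Lemma deriv_level_prod x : x \in r ->
  (FP n A m.+1)^`().[x] = A ^+ edeg n m.+1 * \prod_(y <- r | y != x) (x - y).
Proof.
move=> xr; rewrite rE derivZ hornerZ; congr (_ * _).
rewrite (bigD1_seq x) //= derivM derivXsubC !hornerE subrr mul0r addr0 horner_prod.
by apply: eq_bigr => y _; rewrite !hornerE.
Qed.

(** A multiple root modulo the maximal ideal is a zero of the derivative there, which is a unit
    times x - c. *)
Lemma collision x y : x \in r -> y \in r -> x != y -> x - y \in vmax v -> x - c \in vmax v.
Proof.
move=> xr yr nxy mxy; have [U uU UE] := deriv_level xr.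
have -> : x - c = U^-1 * (U * (x - c)) by rewrite mulKf ?(vunit_neq0 uU).
rewrite vmaxMl //; first by rewrite vunit_vr // rpredV.
rewrite -UE deriv_level_prod // -big_filter.
rewrite (bigD1_seq y) /= ?filter_uniq ?mem_filter ?(eq_sym y) ?nxy //.
rewrite vmaxMl ?rpredX // vmaxMr // big_seq_cond.
by apply: rpred_prod => z /andP[]; rewrite mem_filter => /andP[_ zr] _; rewrite rpredB ?rv.
Qed.

(* Here x is the closest to 1/n of the three colliding roots. *)
Lemma three_collision_min x y z : x \in r -> y \in r -> z \in r ->
  x != y -> x != z -> y != z -> x - c \in vmax v ->
  (exists2 t, t \in v & y - c = t * (x - c)) -> (exists2 t, t \in v & z - c = t * (x - c)) -> False.
Proof.
move=> xr yr zr nxy nxz nyz mx [t vt tE] [s vs sE].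
have x0 : x - c != 0.
  apply: contraNneq nxy => x0; move: tE; rewrite x0 mulr0 => y0.
  by rewrite -(subrK c x) -(subrK c y) x0 y0.
have [U uU] := deriv_level xr; rewrite deriv_level_prod // -big_filter.
rewrite (bigD1_seq y) /= ?filter_uniq ?mem_filter ?(eq_sym y) ?nxy //.
rewrite -big_filter (bigD1_seq z) /= ?filter_uniq ?mem_filter ?(eq_sym z) ?nxz ?nyz ?zr //.
set W := \big[_/_]_(i <- _ | _) _ => E.
have vW : W \in v.
  rewrite /W big_seq_cond; apply: rpred_prod => i /andP[]; rewrite !mem_filter => /and3P[_ _ ir] _.
  by rewrite rpredB ?rv.
(* The derivative U (x - c) is divisible by (x - y) (x - z), and both factors are multiples of x -
   c, so U would be a multiple of x - c. *)
apply: (vunit_vmax uU).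
have -> : U = (x - c) * (A ^+ edeg n m.+1 * ((1 - t) * ((1 - s) * W))).
  apply: (mulIf x0); rewrite -E.
  have -> : x - y = (1 - t) * (x - c) by rewrite mulrBl mul1r -tE; ring.
  have -> : x - z = (1 - s) * (x - c) by rewrite mulrBl mul1r -sE; ring.
  by ring.
by rewrite vmaxMr // !rpredM ?rpredX ?rpredB ?rpred1.
Qed.

Lemma no_three_collision x y z : x \in r -> y \in r -> z \in r ->
  x != y -> x != z -> y != z -> x - c \in vmax v -> y - c \in vmax v -> z - c \in vmax v -> False.
Proof.
pose dv (a b : algC) := exists2 t, t \in v & b = t * a.
have tot a b : dv a b \/ dv b a.
  have [->|a0] := eqVneq a 0; first by right; exists 0; rewrite ?rpred0 ?mul0r.
  have [->|b0] := eqVneq b 0; first by left; exists 0; rewrite ?rpred0 ?mul0r.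
  have [vab|/vr_val] := boolP (a / b \in v); first by right; exists (a / b); rewrite ?divfK.
  by rewrite invf_div => vba; left; exists (b / a); rewrite ?divfK.
have tr a b d : dv a b -> dv b d -> dv a d.
  by move=> [t vt ->] [s vs ->]; exists (s * t); rewrite ?rpredM ?mulrA.
move=> xr yr zr nxy nxz nyz mx my mz.
have [xy|yx] := tot (x - c) (y - c).
  have [xz|zx] := tot (x - c) (z - c); first exact: (@three_collision_min x y z).
  by apply: (@three_collision_min z x y) => //; rewrite 1?eq_sym //; apply: tr zx xy.
have [yz|zy] := tot (y - c) (z - c).
  by apply: (@three_collision_min y x z) => //; rewrite eq_sym.
by apply: (@three_collision_min z x y) => //; rewrite 1?eq_sym //; apply: tr zy yx.
Qed.

(** At each root the differences multiply to the derivative over the leading coefficient, a unit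
    times c - x; the factors c - x multiply to f^(m+1)(c) up to a power of A. *)
Lemma diffprod_level : exists2 U, U \in vunit v & diffprod r = U * l%:R ^+ (2 * k0).+1.
Proof.
have /choice[U UP] x : exists U, x \in r -> U \in vunit v /\
    \prod_(y <- r | y != x) (x - y) = U * (c - x).
  have [xr|] := boolP (x \in r); last by exists 0.
  have [U uU UE] := deriv_level xr; exists (- U / A ^+ edeg n m.+1) => _.
  split; first by rewrite rpredM ?vunitN // rpredV rpredX.
  apply: (mulfI (expf_neq0 (edeg n m.+1) A_neq0)); rewrite -deriv_level_prod // UE.
  by move: (A ^+ _) (expf_neq0 (edeg n m.+1) A_neq0) => B B0; field; apply/andP.
exists ((\prod_(x <- r | x \in r) U x) / A ^+ edeg n m.+1 * u0).
  by rewrite !rpredM ?rpredV ?rpredX //; apply: rpred_prod => x /UP[].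
rewrite /diffprod big_seq (eq_bigr (fun x => U x * (c - x))); last by move=> x /UP[].
rewrite big_split /= -[X in _ * X]big_seq.
have -> : \prod_(x <- r) (c - x) = (FP n A m.+1).[c] / A ^+ edeg n m.+1.
  rewrite rE hornerZ mulrC mulKf ?expf_neq0 // horner_prod.
  by apply: eq_bigr => x _; rewrite !hornerE.
by rewrite FPE cE; ring.
Qed.

Lemma diffprod_rat : diffprod r \in Crat.
Proof.
apply: aut_fixed_rat => s; have pm := perm_map_aut ur (raut s).
rewrite /diffprod rmorph_prod -[RHS](perm_big _ pm) /= big_map; apply: eq_bigr => x _.
rewrite rmorph_prod -[RHS](perm_big _ pm) /= big_map; apply: eq_big => [y|y _].
  by rewrite (inj_eq (fmorph_inj s)).
by rewrite rmorphB.
Qed.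

(** If x were the only preimage of f x, the derivative of f would vanish at x, and x would be a
    multiple root of the iterate. *)
Lemma level_sibling x : x \in r -> exists z, [/\ z \in r, z != x & f z = f x].
Proof.
move=> xr; have [s sE] := closed_field_poly_normal (fP n A - (f x)%:P).
have sz := size_fP_subC n_gt1 A_rat A_neq0 (f x).
have l0 : lead_coef (fP n A - (f x)%:P) != 0 by rewrite lead_coef_eq0 -size_poly_eq0 sz.
have mems z : (z \in s) = (f z == f x).
  rewrite -root_prod_XsubC -(rootZ _ _ l0) -sE rootE hornerD hornerN hornerC fPE.
  by rewrite subr_eq0.
have szs : size s = n.
  by move: sz; rewrite sE size_scale // size_prod_XsubC => -[].
have [/hasP[z zs nz]|/hasPn alls] := boolP (has (predC1 x) s).
  exists z; move: zs; rewrite mems => /eqP fz; split=> //.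
  by rewrite memr iterSr fz -iterSr -memr.
have sx z : z \in s -> z = x by move/alls; rewrite /= negbK => /eqP.
exfalso; suff fd0 : dfC x = 0.
  have := deriv_level_prod xr; rewrite deriv_FP big_ord_recl /= fd0 mul0r => /esym/eqP.
  rewrite mulf_eq0 expf_eq0 (negPf A_neq0) andbF /= prodf_seq_eq0 => /hasP[y yr /andP[nyx]].
  by rewrite subr_eq0 eq_sym (negPf nyx).
have : (fP n A - (f x)%:P)^`().[x] = dfC x.
  by rewrite derivB derivC subr0 deriv_fP.
rewrite sE; case: s szs sx {sE mems alls} => [|a [|b s]].
- by move=> /= E; move: n_gt1; rewrite -E.
- by move=> /= E; move: n_gt1; rewrite -E.
move=> _ sx <-; rewrite !big_cons (sx a) ?mem_head // (sx b) ?inE ?eqxx ?orbT //.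
by rewrite derivZ !derivM !derivXsubC !hornerE subrr !(mul0r, mulr0, addr0).
Qed.

Lemma level_transposition : exists (s : autC) x y,
  [/\ x \in r, y \in r, x != y & f x = f y] /\
  [/\ s x = y, s y = x & forall z, z \in r -> z != x -> z != y -> s z = z].
Proof.
have l0 : l%:R != 0 :> algC by rewrite pnatr_eq0 -lt0n prime_gt0.
have [d d2 dfix] := diffprod_sqrt ur; have [U uU UE] := diffprod_level.
have Dd : exists2 W, W \in vunit v & d ^+ 2 = W * l%:R ^+ (2 * k0).+1.
  by case: d2 => ->; [exists U | exists (- U)]; rewrite ?vunitN // UE mulNr.
(* Removing l^k0 leaves del^2 = l times a unit, as [inertia_neq1] requires. *)
have [W uW WE] := Dd; pose del := d / l%:R ^+ k0.
pose ri (i : 'I_(size r)) := r`_i.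
have ri_mem i : ri i \in r by rewrite mem_nth.
have ri_ex x : x \in r -> exists i, ri i = x.
  move=> xr; have xi := xr; rewrite -index_mem in xi.
  by exists (Ordinal xi); rewrite /ri /= nth_index.
have ri_inj : injective ri.
  by move=> i j /eqP; rewrite nth_uniq // => /eqP /val_inj.
have ri_aut (s : autC) i : exists j, s (ri i) = ri j.
  by have [j <-] := ri_ex _ (raut s (ri_mem i)); exists j.
have del2 : del ^+ 2 = l%:R * W.
  rewrite /del expr_div_n WE exprS mulnC exprM.
  by field; rewrite expf_neq0.
have delQ : del ^+ 2 \in Crat.
  rewrite /del expr_div_n; apply: rpred_div; last by rewrite !rpredX ?rpred_nat.
  by case: d2 => ->; rewrite ?rpredN diffprod_rat.
have [||s [[i si] sm]] := @inertia_neq1 _ ri ri_inj ri_aut l v del W l_pr _ del2 uW delQ.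
- by move=> i; apply: rv.
- move=> s sr; rewrite rmorphM fmorphV rmorphXn rmorph_nat dfix // => x xr.
  by have [j <-] := ri_ex x xr.
have srm x : x \in r -> s x - x \in vmax v by move=> /ri_ex[j <-].
set x := ri i in si; have xr : x \in r by exact: ri_mem.
(* A root moved by inertia collides with its image, hence reduces to c; [no_three_collision] allows
   only two such roots. *)
have moved z : z \in r -> s z != z -> z - c \in vmax v.
  move=> zr nz; apply: (@collision z (s z)) => //; first exact: raut.
    by rewrite eq_sym.
  by rewrite -opprB rpredN srm.
have sI := fmorph_inj s.
have [y yE] : exists y, s x = y by exists (s x).
have yr : y \in r by rewrite -yE; apply: raut.
have mx := moved x xr si; rewrite yE in si.
have ny : s y != y by rewrite -[X in _ != X]yE (inj_eq sI).
have my := moved y yr ny.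
have nxy : x != y by rewrite eq_sym.
have ssr : s y \in r by apply: raut.
have nys : y != s y by rewrite eq_sym.
have sy : s y = x.
  apply/eqP; apply: contraT; rewrite eq_sym => nsy; exfalso.
  have ms : s y - c \in vmax v by apply: moved; rewrite ?(inj_eq sI).
  exact: (no_three_collision xr yr ssr nxy nsy nys mx my ms).
have fixz z : z \in r -> z != x -> z != y -> s z = z.
  move=> zr zx zy; apply/eqP; apply: contraT => nz; exfalso.
  rewrite eq_sym in zx; rewrite eq_sym in zy.
  exact: (no_three_collision xr yr zr nxy zx zy mx my (moved z zr nz)).
exists s, x, y; split; split=> //.
(* Otherwise a sibling z of x differs from y and is fixed by s, so f y = s (f x) = s (f z) = f z = f
   x. *)
apply/eqP; apply: contraT => nf.
have [z [zr zx fz]] := level_sibling xr.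
have zy : z != y by apply: contraNneq nf => zy; rewrite -fz zy.
case/eqP: nf; rewrite -yE -(fC_aut n A_rat s x) -fz (fC_aut n A_rat).
by rewrite (fixz z).
Qed.

End AtCriticalPrime.

(** * Surjectivity *)

Section Family.
Variables (n p q j : nat).
Hypotheses (n_even : ~~ odd n) (n_gt1 : (1 < n)%N) (p_pr : prime p) (q_pr : prime q).
Hypotheses (q_mod8 : (q %% 8 \in [:: 3; 5])%N) (q_co : coprime q (n * n.-1)).
Hypotheses (pq : p != q) (pn : coprime p n).

(** The exponent splits in three: n clears the denominator n^n of f(1/n), 3 makes the remaining
    factor divisible by 8, and j makes the family infinite. *)
Definition coefA : rat := (n ^ (n + 3 + j) * p)%:R / q%:R.
Local Notation A := (ratr coefA : algC).
Local Notation f := (fC n A).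

Let n0 : n%:R != 0 :> algC. Proof. by rewrite pnatr_eq0 -lt0n ltnW. Qed.
Let p0 : p%:R != 0 :> algC. Proof. by rewrite pnatr_eq0 -lt0n prime_gt0. Qed.
Let q0 : q%:R != 0 :> algC. Proof. by rewrite pnatr_eq0 -lt0n prime_gt0. Qed.

Lemma coefAE : A = n%:R ^+ (n + 3 + j) * p%:R / q%:R.
Proof. by rewrite /coefA fmorph_div /= !ratr_nat natrM natrX. Qed.

Lemma coefA_rat : A \in Crat. Proof. exact: Crat_rat. Qed.
Lemma coefA_neq0 : A != 0.
Proof. by rewrite coefAE !mulf_neq0 ?expf_neq0 ?invr_neq0. Qed.

Lemma crit_numE m : iter m.+1 f n%:R^-1 = (crit_num n j p q m)%:~R / q%:R ^+ edeg n m.+1.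
Proof.
have e1 : (1 < n)%N := n_gt1.
elim: m => [|m IH].
  have -> : crit_num n j p q 0 = q%:Z - (n ^ (3 + j) * p * n.-1 ^ n.-1)%:Z by [].
  have -> : edeg n 1 = 1%N by rewrite /edeg muln0.
  rewrite /iter expr1 mulrzBr -!pmulrn 2!natrM 2!natrX /fC coefAE.
  have -> : (n%:R^-1 - 1 : algC) ^+ n.-1 = - (n.-1%:R ^+ n.-1 / n%:R ^+ n.-1).
    have -> : n%:R^-1 - 1 = - (n.-1%:R / n%:R) :> algC.
      have -> : n.-1%:R = n%:R - 1 :> algC by rewrite -[in RHS](prednK (ltnW e1)) -natr1 addrK.
      by field.
    (* The sign is -1 because n is even. *)
    rewrite exprNn expr_div_n -signr_odd (_ : odd n.-1); first by rewrite expr1 mulN1r.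
    by move: n_even; rewrite -{1}(prednK (ltnW e1)) /= negbK.
  have -> : (n%:R : algC) ^+ (n + 3 + j) = n%:R * n%:R ^+ n.-1 * n%:R ^+ (3 + j).
    by rewrite -exprS prednK ?(ltnW e1) // -exprD addnA.
  move: (n.-1%:R ^+ _) (n%:R ^+ (3 + j)) (n%:R ^+ n.-1) (expf_neq0 n.-1 n0) => a b d d0.
  by field; rewrite n0 q0 d0.
rewrite iterS IH; set N := crit_num n j p q m.
have -> : crit_num n j p q m.+1 = (n ^ (n + 3 + j) * p)%:Z * N *
  (N - (q ^ edeg n m.+1)%:Z) ^+ n.-1 + (q ^ edeg n m.+2)%:Z by [].
have key (a b d k : nat) : (a%:Z * N * (N - b%:Z) ^+ k + d%:Z)%:~R =
    a%:R * N%:~R * (N%:~R - b%:R) ^+ k + d%:R :> algC.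
  by rewrite rmorphD !rmorphM rmorphXn rmorphB.
rewrite key natrM !natrX /fC coefAE.
set Q := q%:R ^+ (edeg n m.+1); have Q0 : Q != 0 by rewrite expf_neq0.
have -> : q%:R ^+ edeg n m.+2 = q%:R * (Q * Q ^+ n.-1) :> algC.
  by rewrite -[Q * _]exprS (prednK (ltnW e1)) -exprM mulnC -exprS.
have -> : N%:~R / Q - 1 = (N%:~R - Q) / Q by field.
rewrite expr_div_n.
move: (Q ^+ n.-1) (expf_neq0 n.-1 Q0) ((N%:~R - Q) ^+ _) (n%:R ^+ _) => a a0 b d.
by field; rewrite q0 Q0 a0.
Qed.

(** Here [w] permutes level m + 1 inside the fibres over level m. Such a permutation is a product of
    transpositions of siblings, each of which is realised. *)
Lemma level_full m : exists r : seq algC,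
  [/\ uniq r, forall x, (x \in r) = (iter m.+1 f x == 0),
      FP n A m.+1 = A ^+ edeg n m.+1 *: \prod_(z <- r) ('X - z%:P) &
  forall w : algC -> algC, (forall x, x \in r -> w x \in r /\ f (w x) = f x) ->
    {in r &, injective w} -> exists nu : autC, forall x, x \in r -> nu x = w x].
Proof.
have AQ := coefA_rat; have A0 := coefA_neq0.
have qn : coprime q n by move: q_co; rewrite coprimeMr => /andP[].
have pq' : coprime p q by rewrite prime_coprime // dvdn_prime2.
have [vp _] := valring_exists p_pr; have [vq _] := valring_exists q_pr.
have Ap : A / p%:R \in vunit vp.
  rewrite coefAE (_ : _ / q%:R / p%:R = n%:R ^+ (n + 3 + j) / q%:R); last by field; rewrite p0 q0.
  by apply: rpred_div; rewrite ?rpredX ?vunit_coprime.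
have Aq : A * q%:R \in vunit vq.
  rewrite coefAE divfK //; apply: rpredM; rewrite ?rpredX ?vunit_coprime //.
  by rewrite coprime_sym.
have [r [ur szr memr rE trans]] := level_transitive n_gt1 AQ A0 p_pr Ap m.
exists r; split=> // w wr winj.
have [l [l_pr ln lp lq oddl]] := crit_prime j n_even n_gt1 p_pr q_pr q_mod8 q_co pq m.
have [vl _] := valring_exists l_pr.
have Al : A \in vunit vl.
  by rewrite coefAE; apply: rpred_div; rewrite ?rpredM ?rpredX ?vunit_coprime.
have nl : n%:R \in vunit vl by rewrite vunit_coprime.
have [k0 [u0 u0u cE]] : exists k0, exists2 u0, u0 \in vunit vl &
   iter m.+1 f n%:R^-1 = l%:R ^+ (2 * k0).+1 * u0.
  rewrite crit_numE; set N := crit_num n j p q m in oddl *.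
  have N0 : (0 < `|N|)%N by case: (`|N|)%N oddl => //; rewrite logn0.
  have [t tl tE] := pfactor_coprime l_pr N0.
  exists (logn l `|N|)./2, (((-1) ^+ (N < 0)%R * t%:R) / q%:R ^+ edeg n m.+1).
    apply: rpred_div; last by rewrite rpredX ?vunit_coprime.
    apply: rpredM; last by rewrite vunit_coprime.
    by rewrite rpredX // vunitN rpred1.
  have -> : (2 * (logn l `|N|)./2).+1 = logn l `|N|.
    by rewrite mul2n -[RHS]odd_double_half oddl.
  rewrite {1}[N]intEsign {1}tE rmorphM rmorph_sign /= -pmulrn natrM natrX; ring.
have [s0 [x0 [y0 [E0 T0]]]] := level_transposition n_gt1 AQ A0 l_pr Al nl ur memr rE u0u cE.
(* This relation is invariant under conjugation and nonempty by [level_transposition], so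
   [sibling_transitive] extends it to all pairs of siblings. *)
pose Orel x y := [/\ x \in r, y \in r, x != y & f x = f y] /\ exists s : autC,
  [/\ s x = y, s y = x & forall z, z \in r -> z != x -> z != y -> s z = z].
have raut (nu : autC) x : x \in r -> nu x \in r.
  by rewrite !memr -iter_fC_aut // fmorph_eq0.
have sib x y : x \in r -> y \in r -> x != y -> f x = f y -> Orel x y.
  apply: (sibling_transitive n_gt1 AQ A0 q_pr Aq ur memr trans).
  - by move=> a b [].
  - move=> nu a b [[ar br nab fab] [s [sa sb sfix]]]; split.
      by rewrite !raut // (inj_eq (fmorph_inj nu)) -!fC_aut // fab.
    exists (nu \o (s \o algC_invaut nu) : autC); rewrite /= !algC_autK sa sb; split=> //.
    move=> z zr za zb; rewrite sfix ?algC_invautK //.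
    + exact: (raut (algC_invaut nu : autC)).
    + by apply: contraNneq za => <-; rewrite algC_invautK.
    + by apply: contraNneq zb => <-; rewrite algC_invautK.
  - by exists x0, y0; split=> //; exists s0.
pose ri (i : 'I_(size r)) := r`_i.
have ri_mem i : ri i \in r by rewrite mem_nth.
have ri_ex x : x \in r -> exists i, ri i = x.
  move=> xr; have xi := xr; rewrite -index_mem in xi.
  by exists (Ordinal xi); rewrite /ri /= nth_index.
have ri_inj : injective ri.
  by move=> i k /eqP; rewrite nth_uniq // => /eqP /val_inj.
have /choice[wi wiE] i : exists k, w (ri i) = ri k.
  by have [wir _] := wr _ (ri_mem i); have [k kE] := ri_ex _ wir; exists k.
have wi_inj : injective wi.
  by move=> i k E; apply: ri_inj; apply: winj; rewrite ?ri_mem // !wiE E.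
pose G (s : 'S_(size r)) := exists nu : autC, forall i, nu (ri i) = ri (s i).
have [nu nuE] : G (perm wi_inj).
  apply: (@fibre_perm_ind _ _ (fun i => f (ri i)) G).
  - by exists idfun => i; rewrite perm1.
  - move=> s t [nu nuE] [mu muE]; exists (mu \o nu : autC) => i.
    by rewrite /= nuE muE permM.
  - move=> i k fik; have [->|nik] := eqVneq i k.
      by exists idfun => i'; rewrite tperm1 perm1.
    have [||_ [s [si sk sfix]]] := sib (ri i) (ri k) (ri_mem i) (ri_mem k).
    + by rewrite (inj_eq ri_inj).
    + exact: fik.
    exists s => z; case: tpermP => [->|->|] //.
    by move=> /eqP zi /eqP zk; rewrite sfix ?ri_mem ?(inj_eq ri_inj).
  - by move=> i; rewrite permE -wiE; have [] := wr _ (ri_mem i).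
by exists nu => x /ri_ex[i <-]; rewrite nuE permE wiE.
Qed.

End Family.

Local Open Scope classical_set_scope.

(** * From single levels to automorphisms of the whole tree *)

Section Tree.
Variables (n : nat) (a : rat).
Hypotheses (n_gt1 : (1 < n)%N) (a_neq0 : a != 0).

Definition fQ : {poly rat} := a *: ('X * ('X - 1) ^+ n.-1) + 1.
Local Notation A := (ratr a : algC).
Local Notation f := (fC n A).

Let A_neq0 : A != 0. Proof. by rewrite fmorph_eq0. Qed.

Lemma map_fQ : map_poly QC fQ = fP n A.
Proof.
rewrite /fQ /fP rmorphD /= map_polyZ rmorphM rmorphXn rmorphB rmorph1 /= map_polyX.
by rewrite rmorph1.
Qed.

Lemma map_iter_fQ m : map_poly QC (iter_poly fQ m) = FP n A m.
Proof.
elim: m => [|m IH]; first by rewrite /iter_poly /= map_polyX.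
by rewrite /iter_poly iterS map_comp_poly -/(iter_poly fQ m) IH map_fQ.
Qed.

Lemma iter_fQE m (x : rat) : QC (iter_poly fQ m).[x] = iter m f (QC x).
Proof. by rewrite -horner_map map_iter_fQ FPE. Qed.

Lemma tree_levelE m x : tree_level QC fQ 0 m x <-> iter m f x = 0.
Proof.
rewrite /tree_level /= polyC0 subr0 map_iter_fQ rootE FPE; split=> [/eqP|->] //.
Qed.

Lemma fC_surj y : exists x, f x = y.
Proof.
have sz := size_fP_subC n_gt1 (Crat_rat a) A_neq0 y.
have /closed_rootP[x] : size (fP n A - y%:P) != 1%N by rewrite sz; case: n n_gt1.
rewrite rootE hornerD hornerN hornerC fPE subr_eq0 => /eqP; by exists x.
Qed.

Lemma iter_fC_add0 m k x : iter m f x = 0 -> iter (k.+1 + m) f x = 1.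
Proof. by move=> E; rewrite iterD E iter_fC0. Qed.

Lemma not_periodic_fQ : ~ periodic_pt fQ 0.
Proof.
case=> -[|k] // _ /(congr1 QC); rewrite iter_fQE rmorph0 iter_fC0 //.
by move/eqP; rewrite oner_eq0.
Qed.

Section Automorphism.
Variable u : treeAut QC fQ 0.

Let V := vertex QC fQ 0.
Let inT x := x \in tree_vertices QC fQ 0.

Let inT_lev m x : iter m f x = 0 -> inT x.
Proof. by move=> E; apply: mem_set; exists m => //; apply/tree_levelE. Qed.

Let lev_inT x : inT x -> exists m, iter m f x = 0.
Proof. by move/set_mem => [m _ /tree_levelE E]; exists m. Qed.

(** The tree automorphism as a total function on [algC], with the identity as default off the
    tree. *)
Let g (x : algC) : algC := if pselect (inT x) is left h then val (u (Sub x h : V)) else x.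

Let gE (w : V) : g (val w) = val (u w).
Proof.
rewrite /g; case: pselect => [h|[]]; last exact: (valP w).
by congr (val (u _)); apply: val_inj.
Qed.

Let mkV x (h : inT x) : V := Sub x h.

Let adjE (w w' : V) : tree_adj w w' <-> f (val w) = val w' \/ f (val w') = val w.
Proof. by rewrite /tree_adj map_fQ !fPE. Qed.

Let g_inj x y : inT x -> inT y -> g x = g y -> x = y.
Proof.
move=> hx hy; rewrite -[x]/(val (mkV hx)) -[y]/(val (mkV hy)) !gE => /val_inj.
by move/(bij_inj (aut_bij u)) ->.
Qed.

(** Adjacency is unoriented, so parents must be shown to go to parents. If instead g x were the
    parent of g (f x), then on level 1 it would be f 0 = 1, which is not in the tree; higher up g x
    = g (f (f x)), so x = f (f x) would lie on two levels. *)
Lemma treeAut_level m x : iter m f x = 0 -> iter m f (g x) = 0 /\ ((0 < m)%N -> f (g x) = g (f x)).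
Proof.
elim: m x => [|m IH] x; [move=> /= ->|rewrite iterSr => fx0].
  have r0 : val (tree_root QC fQ 0) = 0 by rewrite /= rmorph0.
  by rewrite -r0 gE aut_root.
have hx : inT x by apply: (@inT_lev m.+1); rewrite iterSr.
have hf : inT (f x) by apply: (@inT_lev m).
have [gf0 gff] := IH _ fx0.
suff E : f (g x) = g (f x) by rewrite iterSr E.
have /(aut_adj u)/adjE : tree_adj (mkV hx) (mkV hf) by apply/adjE; left.
rewrite -!gE /= => -[//|E].
case: m fx0 gf0 gff {IH} => [|m] fx0 gf0 gff.
  move: E; rewrite [g (f x)]gf0 fC0 => gx1.
  have : inT (g x) by rewrite -[x]/(val (mkV hx)) gE; apply: valP.
  by case/lev_inT => k; rewrite -gx1 iter_fC1 // => /eqP; rewrite oner_eq0.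
rewrite gff // in E.
have hff : inT (f (f x)) by apply: (@inT_lev m); rewrite -iterSr.
have xE := g_inj hff hx E.
have x0 : iter m f x = 0 by rewrite -xE -[f (f x)]/(iter 2 f x) -iterD addn2 !iterSr -iterSr.
have := iter_fC_add0 1 x0; rewrite add2n 2!iterSr -iterSr fx0 => /esym/eqP.
by rewrite oner_eq0.
Qed.

Hypothesis full : forall m, exists r : seq algC,
  [/\ uniq r, forall x, (x \in r) = (iter m.+1 f x == 0),
      FP n A m.+1 = A ^+ edeg n m.+1 *: \prod_(z <- r) ('X - z%:P) &
  forall w : algC -> algC, (forall x, x \in r -> w x \in r /\ f (w x) = f x) ->
    {in r &, injective w} -> exists nu : autC, forall x, x \in r -> nu x = w x].

(** If nu agrees with g on level m, then nu^-1 g preserves the fibres of f on level m + 1 and is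
    realised there by some tau; nu tau is the lift. *)
Lemma treeAut_lift m : exists nu : autC, forall x, iter m f x = 0 -> nu x = g x.
Proof.
elim: m => [|m [nu nuE]].
  by exists idfun => x x0; have [g0 _] := treeAut_level x0; rewrite /= in x0 g0; rewrite /= g0 x0.
have [r [ur memr _ rfull]] := full m.
have lr x : x \in r -> iter m.+1 f x = 0 by rewrite memr => /eqP.
have [|x y xr yr /= E|tau tauE] := rfull (fun x => algC_invaut nu (g x)).
- move=> x xr; have [gx0 gxf] := treeAut_level (lr x xr).
  have AQ := Crat_rat a.
  rewrite memr -(iter_fC_aut n AQ (algC_invaut nu)) gx0 rmorph0 eqxx; split=> //.
  rewrite -(fC_aut n AQ (algC_invaut nu)) gxf // -nuE; first exact: algC_autK.
  by rewrite -iterSr lr.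
- have /(fmorph_inj (algC_invaut nu)) E' := E.
  by apply: g_inj E'; apply: (@inT_lev m.+1); apply: lr.
exists (nu \o tau : autC) => x x0 /=; rewrite tauE ?algC_invautK //.
by rewrite memr x0.
Qed.

(** Every vertex of a lower level is the parent of some vertex, and both maps commute with f. *)
Lemma treeAut_lift_le m (nu : autC) : (forall x, iter m f x = 0 -> nu x = g x) ->
  forall k x, (k <= m)%N -> iter k f x = 0 -> nu x = g x.
Proof.
elim: m => [|m IH] nuE k x.
  by rewrite leqn0 => /eqP->; apply: nuE.
rewrite leq_eqVlt => /orP[/eqP->|]; first exact: nuE.
rewrite ltnS; apply: IH => {k}x x0; have [z zE] := fC_surj x.
have z0 : iter m.+1 f z = 0 by rewrite iterSr zE.
have [_ gz] := treeAut_level z0.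
by rewrite -zE fC_aut ?Crat_rat // nuE // gz.
Qed.

Lemma arboreal_rep_surj : exists s : absGal QC, arboreal_rep fQ 0 s = u.
Proof.
have /choice[sigma sigmaE] := treeAut_lift.
have [nu nuE] := aut_limit sigma.
have nubij : bijective nu by exists (algC_invaut nu); [exact: algC_autK | exact: algC_invautK].
have nufix (b : rat) : nu (QC b) = QC b by rewrite /= fmorph_rat.
exists (AbsGal nubij nufix); apply: treeAut_ext => w; apply: val_inj.
rewrite -gE /=; have [k k0] := lev_inT (valP w).
apply: nuE; exists k => m km; exact: (treeAut_lift_le (sigmaE m) km k0).
Qed.

End Automorphism.
End Tree.

Theorem theorem1p4 (n : nat) (n_ge20 : (20 <= n)%N) (n_even : ~~ odd n) :
  infinite_set [set f : {poly rat} |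
    [/\ size f = n.+1,
        ~ periodic_pt f 0,
        forall m : nat, (1 <= m)%N -> separable_poly (iter_poly f m) &
        forall u : treeAut (ratr : {rmorphism rat -> algC}) f 0,
          exists s : absGal (ratr : {rmorphism rat -> algC}),
            arboreal_rep f 0 s = u]].
Proof.
have n_gt1 : (1 < n)%N by apply: leq_trans n_ge20.
have [q [q_pr q_mod8 q_co]] := exists_prime_mod8 n_gt1.
(* Exceeding n + q makes p different from q and prime to n. *)
have [p p_gt p_pr] := prime_above (n + q).
have pq : p != q by rewrite gtn_eqF // (leq_ltn_trans _ p_gt) // leq_addl.
have pn : coprime p n.
  rewrite prime_coprime //; apply/negP => /dvdn_leq.
  by rewrite ltnW // leqNgt (leq_ltn_trans _ p_gt) ?leq_addr // => /(_ isT).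
pose F j := fQ n (coefA n p q j).
have q0 : q%:R != 0 :> rat by rewrite pnatr_eq0 -lt0n prime_gt0.
have A0 j : coefA n p q j != 0.
  by rewrite mulf_neq0 ?invr_neq0 // pnatr_eq0 -lt0n muln_gt0 expn_gt0 (ltnW n_gt1) prime_gt0.
move=> finS; apply: infinite_nat.
have -> : [set: nat] = F @^-1` [set f : {poly rat} |
    [/\ size f = n.+1, ~ periodic_pt f 0,
        forall m : nat, (1 <= m)%N -> separable_poly (iter_poly f m) &
        forall u : treeAut (ratr : {rmorphism rat -> algC}) f 0,
          exists s : absGal (ratr : {rmorphism rat -> algC}), arboreal_rep f 0 s = u]].
  rewrite predeqE => j; split=> // _ /=.
  have AC0 : ratr (coefA n p q j) != 0 :> algC by rewrite fmorph_eq0.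
  have full := level_full j n_even n_gt1 p_pr q_pr q_mod8 q_co pq pn.
  split.
  - rewrite -(size_map_poly (ratr : {rmorphism rat -> algC})) map_fQ size_fP //.
    exact: Crat_rat.
  - exact: not_periodic_fQ.
  - case=> // m _; have [r [ur _ rE _]] := full m.
    rewrite -(separable_map (ratr : {rmorphism rat -> algC})) map_iter_fQ rE.
    by rewrite (eqp_separable (eqp_scale _ (expf_neq0 _ AC0))) separable_prod_XsubC.
  - by move=> u; apply: arboreal_rep_surj.
(* The family is injective in j, since the leading coefficient determines the exponent of n. *)
apply: finite_preimage finS => i j _ _.
move/(congr1 (fun P : {poly rat} => lead_coef (map_poly QC P))).
rewrite !map_fQ !lead_fP ?fmorph_eq0 ?A0 ?Crat_rat // => /fmorph_inj.
move/(mulIf (invr_neq0 q0))/eqP; rewrite eqr_nat eqn_pmul2r ?prime_gt0 //.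
by rewrite eqn_exp2l // eqn_add2l => /eqP.
Qed.
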